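(* Let $\varphi\in\mathrm{Image}(\pi)\subset Map(2^{[5]},\mathbb N)$, and let $\mathcal O\subset\pi^{-1}(\varphi)\subset(\mathbb P^3)^5$ be a $GL_4$-orbit. (1) If $\mathcal O=\pi^{-1}(\varphi)$, then $\overline{\mathcal O}=\coprod_{\psi\le\varphi}\pi^{-1}(\psi)$, where $\psi$ runs over $\mathrm{Image}(\pi)$. (2) If $\mathcal O\subsetneq\pi^{-1}(\varphi)$, then for every $\psi\in\mathrm{Image}(\pi)$: (a) $\pi^{-1}(\psi)\cap\overline{\mathcal O}\ne\emptyset$ if and only if $\psi\preceq\varphi$; (b) $\pi^{-1}(\psi)\subset\overline{\mathcal O}$ if and only if either $\psi\preceq\varphi$ and $\pi^{-1}(\psi)$ is a single $GL_4$-orbit, or $\psi\prec\varphi$.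
   Context: $\mathbb K$ is an algebraically closed field of characteristic $0$; $\mathbb P^3$ is the projective space of lines in $\mathbb K^4$; $[5]=\{1,\dots,5\}$; $\mathbb N=\{0,1,2,\dots\}$. $GL_4=GL_4(\mathbb K)$ acts diagonally on $(\mathbb P^3)^5$, and $\overline{\mathcal O}$ is the Zariski closure in $(\mathbb P^3)^5$. The $GL_4$-invariant map $\pi\colon(\mathbb P^3)^5\to Map(2^{[5]},\mathbb N)$ is $\pi([v_i]_{i=1}^5)\colon I\mapsto\dim\mathrm{Span}\{v_i\}_{i\in I}$. An $r$-face of $\varphi$ is an inclusion-maximal element of $\varphi^{-1}(r)\subset 2^{[5]}$. Map $\rho$: for a finite set $S$, a map $\varphi\colon 2^{S}\to\mathbb N$ is decomposable if there is a partition $S=S_1\amalg S_2$ into non-empty sets with $\varphi(I)=\varphi(I\cap S_1)+\varphi(I\cap S_2)$ for all $I\subset S$; otherwise indecomposable. For $\varphi\in Map(2^{[5]},\mathbb N)$, $\rho(\varphi)=\{I_k^{r_k}\}_{k=1}^l$ is the (unique) partition $[5]=\coprod_{k=1}^l I_k$ into non-empty sets, with integers $r_k$ attached, such that $\varphi(I)=\sum_{k}\varphi(I\cap I_k)$ for all $I\subset[5]$, $r_k=\varphi(I_k)$, and each restriction $\varphi|_{I_k}$ (to subsets of $I_k$) is indecomposable. Relations on $\mathrm{Image}(\pi)$: - $\psi\le\varphi$ if $\psi(I)\le\varphi(I)$ for all $I\subset[5]$. - $\prec$ is the (strict) partial order generated by the relations $\psi\prec\varphi$ whenever $\rho(\varphi)=\{I_k^{r_k}\}_{k=1}^l$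 and $\rho(\psi)=\{I_k^{s_k}\}_{k=1}^l$ (with the same underlying partition), $\psi\le\varphi$, and $s_k<r_k$ for some $1\le k\le l$. - $\preceq$ is the (reflexive) partial order generated by the relations $\psi\preceq\varphi$ whenever one of the following holds: (i) there is an $r$-face $J$ of $\varphi$ (for some $r$) such that $\psi(I)=\varphi(I\cup J)+\varphi(I\cap J)-\varphi(J)$ for all $I\subset[5]$; (ii) $\rho(\varphi)=\{I_k^{r_k}\}_{k=1}^l$, $\psi\le\varphi$, and $\psi|_{I_k}=\varphi|_{I_k}$ for all $k$; (iii) $\psi\prec\varphi$. *)

(* Defs.v *)
From mathcomp Require Import all_boot all_order all_algebra.
From mathcomp Require Import mpoly.
From mathcomp Require Import classical_sets.
From Stdlib Require Import Relation_Operators.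

Set Implicit Arguments.
Unset Strict Implicit.
Unset Printing Implicit Defensive.

Import GRing.Theory.

Local Open Scope classical_set_scope.
Local Open Scope ring_scope.

(* Maps 2^T -> N; finite functions, so that equality is extensional. *)
Notation setfun T := {ffun {set T} -> nat}.

Definition setfun_le (T : finType) (psi phi : setfun T) : Prop :=
  forall I : {set T}, (psi I <= phi I)%N.

(* Decomposability of the restriction of phi to the subsets of S. *)
Definition decomposable (T : finType) (phi : setfun T) (S : {set T}) : bool :=
  [exists S1 : {set T}, exists S2 : {set T},
    [&& S1 :|: S2 == S, [disjoint S1 & S2], S1 != finset.set0, S2 != finset.set0
      & [forall I : {set T}, (I \subset S) ==>
          (phi I == phi (I :&: S1) + phi (I :&: S2))%N]]].

(* P is the underlying partition {I_k} of rho(phi); the integer attached to a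
   block B is phi B. *)
Definition rho_partition (T : finType) (phi : setfun T) (P : {set {set T}}) : bool :=
  [&& finset.partition P finset.setT,
      [forall I : {set T}, phi I == (\sum_(B in P) phi (I :&: B))%N]
    & [forall B in P, ~~ decomposable phi B]].

Definition is_face (T : finType) (phi : setfun T) (r : nat) (J : {set T}) : bool :=
  maxset (fun I : {set T} => phi I == r) J.

Definition P3 (K : fieldType) : Type := {U : {vspace 'rV[K]_4} | \dim U == 1%N}.

Definition config (K : fieldType) : Type := {ffun 'I_5 -> P3 K}.

Definition span_dim (K : fieldType) (x : config K) : setfun 'I_5 :=
  [ffun I : {set 'I_5} => \dim (\sum_(i in I) val (x i))%VS].

Definition image_pi (K : fieldType) : set (setfun 'I_5) := range (@span_dim K).

Definition fiber (K : fieldType) (phi : setfun 'I_5) : set (config K) :=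
  [set x | span_dim x = phi].

(* Vectors are rows, so g in GL_4 acts by v |-> v *m g; the orbits are the same
   as for the left action on columns, via transposition. *)
Definition GL_orbit (K : fieldType) (x : config K) : set (config K) :=
  [set y | exists2 g : 'M[K]_4, g \in unitmx &
     forall i, val (y i) = (linfun (mulmxr g) @: val (x i))%VS].

Definition is_GL_orbit (K : fieldType) (A : set (config K)) : Prop :=
  exists x, A = GL_orbit x.

(* The 20 homogeneous coordinates on (P^3)^5 are the entries of a 5 x 4 matrix
   whose rows represent the points; mxvec_index i j is the variable for the
   j-th coordinate of the i-th point. *)
Definition multihomogeneous (K : fieldType) (p : {mpoly K[5 * 4]}) : Prop :=
  exists d : 'I_5 -> nat, forall m : 'X_{1..5 * 4}, m \in msupp p ->
    forall i : 'I_5, (\sum_(j < 4) m (mxvec_index i j))%N = d i.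

Definition vanishes_at (K : fieldType) (p : {mpoly K[5 * 4]}) (x : config K) : Prop :=
  forall M : 'M[K]_(5, 4), (forall i, val (x i) = <[row i M]>%VS) ->
    p.@[fun k => mxvec M 0 k] = 0.

Definition zariski_closed (K : fieldType) (Z : set (config K)) : Prop :=
  exists2 F : set {mpoly K[5 * 4]}, F `<=` @multihomogeneous K
    & Z = [set x | forall p, F p -> vanishes_at p x].

Definition zariski_closure (K : fieldType) (A : set (config K)) : set (config K) :=
  \bigcap_(Z in [set Z | zariski_closed Z /\ A `<=` Z]) Z.

(* The generating relations below relate elements of Image(pi) only, so that
   the chains witnessing the generated orders stay inside Image(pi). *)
Definition prec_gen (K : fieldType) (psi phi : setfun 'I_5) : Prop :=
  [/\ image_pi K psi, image_pi K phi, setfun_le psi phi &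
    exists P : {set {set 'I_5}},
      [/\ rho_partition phi P, rho_partition psi P
        & exists2 B, B \in P & (psi B < phi B)%N]].

Definition prec (K : fieldType) : setfun 'I_5 -> setfun 'I_5 -> Prop :=
  clos_trans _ (@prec_gen K).

(* psi I = phi (I :|: J) + phi (I :&: J) - phi J, without truncated subtraction *)
Definition face_degeneration (psi phi : setfun 'I_5) : Prop :=
  exists (r : nat) (J : {set 'I_5}), is_face phi r J /\
    forall I : {set 'I_5}, (psi I + phi J = phi (I :|: J) + phi (I :&: J))%N.

Definition block_degeneration (psi phi : setfun 'I_5) : Prop :=
  setfun_le psi phi /\
  exists2 P : {set {set 'I_5}}, rho_partition phi P &
    forall B, B \in P -> forall I : {set 'I_5}, I \subset B -> psi I = phi I.

Definition preceq_gen (K : fieldType) (psi phi : setfun 'I_5) : Prop :=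
  [/\ image_pi K psi, image_pi K phi &
    [\/ face_degeneration psi phi, block_degeneration psi phi | prec K psi phi]].

Definition preceq (K : fieldType) : setfun 'I_5 -> setfun 'I_5 -> Prop :=
  clos_refl_trans _ (@preceq_gen K).

(* Main.v *)
(** A configuration is represented by a 5 x 4 matrix M up to row scaling, orbits are orbits of
    torus x GL_4, and [phi] is the rank function of the rows.  There are 184 loopless matroids
    of rank at most 4 on five labelled elements.

    Points of a closure are produced by polynomial curves.  For every matroid the matrices of
    rank function at most [phi] are parametrized by matrix factorizations, so interpolating the
    factors joins any of them to the stratum of [phi]: the closure of the whole stratum is the
    union of the smaller strata.  If some basis of [phi] has an acyclic fundamental graph
    ([phi] is "tame"), row and column scalings identify any two realizations, so the stratum is
    one orbit.  The 27 remaining ("wild") matroids all have a U_{2,4} minor.  Face degenerations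
    are limits of one-parameter subgroups.  For wild connected [phi] of rank 3, a linear map
    sending the five given points of the plane into five prescribed lines of K^2 exists because
    it solves five linear equations in six unknowns; hence every configuration of rank at most 2
    is a limit of the orbit.

    Conversely, each U_{2,4} minor of [phi] gives the multihomogeneous equation
    [eab][ecd] = la [eac][ebd] with la <> 0 on the orbit closure.  Hence, at every limit, the
    three bracket products vanish simultaneously; for wild [phi] this combinatorial condition
    together with [psi <= phi] implies [psi] preceq [phi].  If moreover [psi] is wild and not
    below [phi] for prec, then it has a U_{2,4} minor in common with [phi] for which moving one
    point inside the stratum of [psi] changes the cross-ratio, so the whole stratum is not
    contained in the closure. *)

From Stdlib Require Import NArith Arith.
Require Import Defs.
From mathcomp Require Import all_boot all_order all_algebra.
From mathcomp Require Import mpoly.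
From mathcomp Require Import ring zify.
From Stdlib Require Import Relation_Operators.

Set Implicit Arguments.
Unset Strict Implicit.
Unset Printing Implicit Defensive.

(** * Finite computations with rank functions on five elements *)

Definition ords : seq 'I_5 :=
  [:: @Ordinal 5 0 isT; @Ordinal 5 1 isT; @Ordinal 5 2 isT; @Ordinal 5 3 isT;
      @Ordinal 5 4 isT].

Lemma mem_ords i : i \in ords.
Proof. by case: i => [[|[|[|[|[|]]]]]]. Qed.

(* Subsets of ['I_5] are encoded by the binary digits of the numbers below 32, and set
   functions by the list of their 32 values, so that statements about all matroids on five
   elements can be decided by computation. *)
Definition masks : seq N := map N.of_nat (iota 0 32).

Definition mem_mask (k : N) (i : 'I_5) : bool := N.testbit k (N.of_nat i).

Definition msk (k : N) : {set 'I_5} := [set i | mem_mask k i]%SET.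

Definition bit (i : 'I_5) : N := N.shiftl 1 (N.of_nat i).

Definition idx (I : {set 'I_5}) : N :=
  foldr N.lor 0%num [seq (if i \in I then bit i else 0%num) | i <- ords].

Definition pc (k : N) : nat := count (mem_mask k) ords.

Lemma msk_lor j k : msk (N.lor j k) = (msk j :|: msk k)%SET.
Proof. by apply/setP => i; rewrite !inE /mem_mask N.lor_spec. Qed.

Lemma msk_land j k : msk (N.land j k) = (msk j :&: msk k)%SET.
Proof. by apply/setP => i; rewrite !inE /mem_mask N.land_spec. Qed.

Lemma msk_ldiff j k : msk (N.ldiff j k) = (msk j :\: msk k)%SET.
Proof. by apply/setP => i; rewrite !inE /mem_mask N.ldiff_spec andbC. Qed.

Lemma msk_bit i : msk (bit i) = [set i]%SET.
Proof.
apply/setP => j; rewrite !inE /mem_mask.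
by case: i => [[|[|[|[|[|]]]]] //= ?]; case: j => [[|[|[|[|[|]]]]] //= ?].
Qed.

Lemma msk0 : msk 0 = set0%SET.
Proof. by apply/setP => i; rewrite !inE. Qed.

Lemma msk31 : msk 31 = setT%SET.
Proof. by apply/setP => i; rewrite !inE; case: i => [[|[|[|[|[|]]]]]]. Qed.

Lemma idxK I : msk (idx I) = I.
Proof.
apply/setP => i; rewrite /idx /= !msk_lor !(fun_if msk) !msk_bit msk0 !inE.
have E (j : 'I_5) : (i \in if j \in I then [set j]%SET else set0%SET) = (i == j) && (i \in I).
  by case: (boolP (j \in I)) => jI; rewrite !inE; case: eqP => //= ->; rewrite ?jI //; apply/esym/negbTE.
by rewrite !E orbF -!andb_orl -[RHS]andTb; congr (_ && _); case: i {E} => [[|[|[|[|[|]]]]]].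
Qed.

Lemma idx_masks I : idx I \in masks.
Proof.
rewrite /idx /=; do 5! case: (_ \in I); exact: isT.
Qed.

Lemma card_msk k : #|msk k| = pc k.
Proof.
rewrite /pc; have -> : ords = enum 'I_5 by apply: (inj_map val_inj); rewrite val_enum_ord.
by rewrite cardE {1}/enum_mem size_filter enumT; apply: eq_count => i; rewrite /= inE.
Qed.

(** Reducing [k] modulo 32 makes [getE] hold for every [k], since [msk] also reads only the five
    lowest digits. *)
Definition get (l : seq nat) (k : N) : nat := nth 0 l (N.to_nat (N.land k 31)).

Definition code (phi : setfun 'I_5) : seq nat := [seq phi (msk k) | k <- masks].

Lemma getE phi k : get (code phi) k = phi (msk k).
Proof.
have klt : leq (N.to_nat (N.land k 31)).+1 32.
  have kE : N.land k 31 = N.modulo k 32 by apply: (N.land_ones k 5).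
  have h : N.lt (N.land k 31) 32 by rewrite kE; apply: N.mod_lt.
  by apply/ltP; apply: (proj1 (Nat.compare_lt_iff _ _)); move: h; rewrite /N.lt N2Nat.inj_compare.
rewrite /get /code (nth_map 0%num) ?size_map ?size_iota //.
rewrite /masks (nth_map 0) ?size_iota // nth_iota // add0n N2Nat.id msk_land msk31.
by rewrite setIT.
Qed.

Lemma get_idx phi I : get (code phi) (idx I) = phi I.
Proof. by rewrite getE idxK. Qed.

Lemma code_inj : injective code.
Proof. by move=> phi psi E; apply/ffunP => I; rewrite -!get_idx E. Qed.

(** * Axioms and enumeration of the loopless matroids of rank at most 4 on five elements *)

Definition ranklike (phi : setfun 'I_5) : Prop :=
  [/\ phi set0%SET = 0, forall i, phi [set i]%SET = 1, forall I, phi I <= 4,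
      forall i I, phi I <= phi (i |: I)%SET <= (phi I).+1
    & forall I J, phi (I :|: J)%SET + phi (I :&: J)%SET <= phi I + phi J]%N.

Definition clear (k : N) (i : 'I_5) : N := N.ldiff k (bit i).

Lemma msk_clear k i : msk (clear k i) = (msk k :\ i)%SET.
Proof. by rewrite msk_ldiff msk_bit. Qed.

(** A local form of the axioms: the value [v] at [k] is compared with the values at the sets
    obtained by removing one or two elements, whose masks are smaller than [k] and already
    decided. *)
Definition ok_ext (l : seq nat) (k : N) (v : nat) : bool :=
  let B := [seq i <- ords | mem_mask k i] in
  [&& (k == 0%num) ==> (v == 0), (size B == 1) ==> (v == 1),
      all (fun i => get l (clear k i) <= v <= (get l (clear k i)).+1)%N B
    & all (fun i => all (fun j => (i == j) ||
        (v + get l (clear (clear k i) j) <= get l (clear k i) + get l (clear k j))%N) B) B].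

Fixpoint enumr (n : nat) : seq (seq nat) :=
  if n is n'.+1 then
    flatten [seq [seq rcons l v | v <- [seq v <- iota 0 5 | ok_ext l (N.of_nat n') v]] | l <- enumr n']
  else [:: [::]].

Definition matroids := Eval vm_compute in enumr 32.

Lemma matroidsE : matroids = enumr 32.
Proof. by vm_cast_no_check (erefl matroids). Qed.

(** Every prefix of [code phi] passes the local tests, so induction on its length places it in the
    enumeration. *)
Lemma code_matroid phi : ranklike phi -> code phi \in matroids.
Proof.
case=> phi0 phi1 phi4 phiU phiS; rewrite matroidsE.
have sz : size (code phi) = 32 by rewrite size_map.
suff H n : (n <= 32)%N -> take n (code phi) \in enumr n.
  by move: (H 32 isT); rewrite take_oversize // sz.
elim: n => [|n IHn] nle; first by rewrite take0.
have getT k : (N.to_nat (N.land k 31) < n)%N -> get (take n (code phi)) k = phi (msk k).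
  by move=> kn; rewrite /get nth_take // -getE.
(* Removing an element lowers the mask, so every value consulted lies in the prefix of length
   [n]. *)
have ltc : all (fun k => all (fun i => mem_mask (N.of_nat k) i ==>
   (N.to_nat (N.land (clear (N.of_nat k) i) 31) < k)%N) ords) (iota 0 32) by vm_compute.
have ltc2 : all (fun k => all (fun i => mem_mask (N.of_nat k) i ==> all (fun j =>
   (N.to_nat (N.land (clear (clear (N.of_nat k) i) j) 31) < k)%N) ords) ords) (iota 0 32) by vm_compute.
have nI : n \in iota 0 32 by rewrite mem_iota.
apply/flatten_mapP; exists (take n (code phi)); first exact/IHn/ltnW.
have Ev : phi (msk (N.of_nat n)) = nth 0 (code phi) n.
  rewrite (nth_map 0%num) ?size_map ?size_iota //.
  by rewrite /masks (nth_map 0) ?size_iota // nth_iota.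
rewrite (take_nth 0) ?sz // -Ev; apply/mapP; exists (phi (msk (N.of_nat n))) => //.
rewrite mem_filter mem_iota /= ltnS phi4 andbT /ok_ext.
have gC i : mem_mask (N.of_nat n) i -> get (take n (code phi)) (clear (N.of_nat n) i) = phi (msk (N.of_nat n) :\ i)%SET.
  move=> h; rewrite getT ?msk_clear //.
  by have /allP/(_ i (mem_ords i))/implyP := allP ltc _ nI; apply.
have gC2 i j : mem_mask (N.of_nat n) i -> get (take n (code phi)) (clear (clear (N.of_nat n) i) j) = phi (msk (N.of_nat n) :\ i :\ j)%SET.
  move=> h; rewrite getT ?msk_clear //.
  by have /allP/(_ i (mem_ords i))/implyP/(_ h)/allP/(_ j (mem_ords j)) := allP ltc2 _ nI.
apply/and4P; split.
- by apply/implyP => /eqP ->; rewrite msk0 phi0.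
- apply/implyP; rewrite size_filter -/(pc _) -card_msk => /cards1P[i ->].
  by rewrite phi1.
- apply/allP => i; rewrite mem_filter => /andP[h _]; rewrite gC //.
  have := phiU i (msk (N.of_nat n) :\ i)%SET.
  by rewrite setD1K // inE.
- apply/allP => i; rewrite mem_filter => /andP[hi _].
  apply/allP => j; rewrite mem_filter => /andP[hj _].
  case: eqP => //= /eqP ij; rewrite !gC // gC2 //.
  have := phiS (msk (N.of_nat n) :\ i)%SET (msk (N.of_nat n) :\ j)%SET.
  congr (phi _ + phi _ <= _)%N; apply/setP => x; rewrite !inE.
    have [->|_] := eqVneq x i; first by rewrite ij.
    by case: (mem_mask _ x); rewrite /= ?andbF ?orbT.
  by case: (x == i); case: (x == j); rewrite ?andbF ?andbb.
Qed.

(* Unlike [all] and [has], these stop early under call-by-value evaluation. *)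
Fixpoint allb (T : Type) (p : pred T) (s : seq T) : bool :=
  if s is x :: s' then if p x then allb p s' else false else true.

Fixpoint hasb (T : Type) (p : pred T) (s : seq T) : bool :=
  if s is x :: s' then if p x then true else hasb p s' else false.

Arguments allb : simpl never.
Arguments hasb : simpl never.

Lemma allbE T (p : pred T) s : allb p s = all p s.
Proof. by elim: s => [|x s IH] //=; rewrite -IH /allb /hasb; case: (p x). Qed.

Lemma hasbE T (p : pred T) s : hasb p s = has p s.
Proof. by elim: s => [|x s IH] //=; rewrite -IH /allb /hasb; case: (p x). Qed.

Lemma allbP (T : eqType) (p : pred T) s : reflect {in s, forall x, p x} (allb p s).
Proof. by rewrite allbE; apply: allP. Qed.

Lemma hasbP (T : eqType) (p : pred T) s : reflect (exists2 x, x \in s & p x) (hasb p s).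
Proof. by rewrite hasbE; apply: hasP. Qed.

Lemma allb_masks (p : pred N) : reflect (forall k, k \in masks -> p k) (allb p masks).
Proof. exact: allbP. Qed.

(** * Decision procedures for the relations on rank functions *)

Definition lec (g f : seq nat) : bool :=
  allb (fun I => get g I <= get f I)%N masks.

Lemma lecP psi phi : reflect (setfun_le psi phi) (lec (code psi) (code phi)).
Proof.
apply: (iffP (allb_masks _)) => h; last by move=> k _; rewrite !getE.
by move=> I; rewrite -!get_idx; apply/h/idx_masks.
Qed.

Definition separator (phi : setfun 'I_5) (B : {set 'I_5}) : Prop :=
  forall I, phi I = (phi (I :&: B) + phi (I :\: B))%N.

Definition sepc (f : seq nat) (B : N) : bool :=
  allb (fun I => get f I == get f (N.land I B) + get f (N.ldiff I B))%N masks.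

Lemma sepcP phi B : reflect (separator phi (msk B)) (sepc (code phi) B).
Proof.
apply: (iffP (allb_masks _)) => h.
  by move=> I; have /eqP := h _ (idx_masks I); rewrite !getE msk_land msk_ldiff idxK.
by move=> k _; rewrite !getE msk_land msk_ldiff; apply/eqP/h.
Qed.

Definition decc (f : seq nat) (B : N) : bool :=
  hasb (fun S0 => let S1 := N.land S0 B in let S2 := N.ldiff B S1 in
    if pc S1 == 0 then false else if pc S2 == 0 then false else
    allb (fun I => get f (N.land I B) == get f (N.land I S1) + get f (N.land I S2))%N masks)
    masks.

Lemma deccP phi B : decomposable phi (msk B) = decc (code phi) B.
Proof.
apply/existsP/hasbP => [[S1 /existsP[S2 /and5P[/eqP US dS S1n S2n /forallP h]]]|[S0 _ /=]].
  have S1B : (S1 \subset msk B)%SET by rewrite -US subsetUl.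
  have E1 : msk (N.land (idx S1) B) = S1 by rewrite msk_land idxK; apply/setIidPl.
  have E2 : msk (N.ldiff B (N.land (idx S1) B)) = S2.
    by rewrite msk_ldiff E1 -US setDUl setDv set0U; apply/setDidPl; rewrite disjoint_sym.
  exists (idx S1); first exact: idx_masks.
  rewrite /= -!card_msk E1 E2 !cards_eq0 (negbTE S1n) (negbTE S2n) /=.
  apply/allbP => I _; rewrite !getE [msk (N.land I B)]msk_land.
  have /implyP := h (msk I :&: msk B); rewrite subsetIr => /(_ isT)/eqP ->.
  rewrite !(msk_land I (N.land _ _)) (msk_land I (N.ldiff _ _)) E1 E2 -!setIA; apply/eqP.
  by congr (phi (_ :&: _) + phi (_ :&: _))%N; apply/setIidPr; rewrite // -US subsetUr.
case: eqP => // /eqP n1; case: eqP => // /eqP n2 /allbP h.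
exists (msk (N.land S0 B)); apply/existsP; exists (msk (N.ldiff B (N.land S0 B))).
rewrite -!cards_eq0 !card_msk n1 n2 /= msk_ldiff msk_land; apply/and3P; split.
- by apply/eqP/setP => i; rewrite !inE; case: (mem_mask B i); case: (mem_mask S0 i).
- by rewrite -setI_eq0; apply/eqP/setP => i; rewrite !inE; case: (mem_mask B i); case: (mem_mask S0 i).
apply/forallP => I; apply/implyP => IB; have /eqP := h _ (idx_masks I).
by rewrite !getE !(msk_land, msk_ldiff) idxK; move/setIidPl: IB => ->; move->.
Qed.

(** The block of [i] is the intersection of all separators containing [i]. That these blocks form
    the partition rho is verified afterwards by [rhoc]. *)
Definition comps (f : seq nat) : seq N :=
  let seps := filter (sepc f) masks in
  undup [seq foldr N.land 31%num [seq B <- seps | mem_mask B i] | i <- ords].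

Definition rhoc (f : seq nat) (Ps : seq N) : bool :=
  [&& [&& all (fun B => pc B != 0) Ps, uniq Ps
        & all (fun B => all (fun B' => (B == B') || (pc (N.land B B') == 0)) Ps) Ps],
      all (fun i => has (fun B => mem_mask B i) Ps) ords,
      all (fun I => get f I == sumn [seq get f (N.land I B) | B <- Ps]) masks
    & all (fun B => ~~ decc f B) Ps].

Definition blocks (Ps : seq N) : {set {set 'I_5}} := [set B in map msk Ps]%SET.

Lemma mem_blocks Ps B : reflect (exists2 k, k \in Ps & B = msk k) (B \in blocks Ps).
Proof. by rewrite inE; apply: mapP. Qed.

Lemma rhocP phi Ps : rhoc (code phi) Ps -> rho_partition phi (blocks Ps).
Proof.
case/and4P => /and3P[/allP n0 uPs /allP dP] /allP cP /allP sP /allP iP.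
have nz k : k \in Ps -> msk k != set0 by move=> /n0; rewrite -cards_eq0 card_msk.
have dj j k : j \in Ps -> k \in Ps -> j != k -> msk j :&: msk k = set0.
  move=> jP kP /negbTE njk; have /allP/(_ _ kP) := dP _ jP.
  by rewrite njk -card_msk msk_land cards_eq0 => /eqP.
have uP : uniq (map msk Ps).
  rewrite map_inj_in_uniq // => j k jP kP E; apply/eqP/negP => /negP njk.
  by have := dj _ _ jP kP njk; rewrite -E setIid; apply/eqP/nz.
apply/and3P; split.
- rewrite /partition; apply/and3P; split.
  + rewrite eqEsubset subsetT /=; apply/subsetP => i _.
    have /hasP[k kP ki] := cP i (mem_ords i).
    by apply/bigcupP; exists (msk k); [apply/mem_blocks; exists k | rewrite inE].
  + apply/trivIsetP => A B /mem_blocks[j jP ->] /mem_blocks[k kP ->] njk.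
    by rewrite -setI_eq0 dj //; apply: contraNneq njk => ->.
  + apply/negP => /mem_blocks[k /nz h E]; by rewrite -E eqxx in h.
- apply/forallP => I; have /eqP := sP _ (idx_masks I); rewrite get_idx => ->.
  rewrite sumnE big_map; apply/eqP.
  rewrite (eq_bigl (mem (map msk Ps))); last by move=> B; rewrite inE.
  rewrite -big_uniq // big_map; apply: eq_bigr => B _.
  by rewrite getE msk_land idxK.
- apply/forallP => B; apply/implyP => /mem_blocks[k kP ->].
  by rewrite deccP; apply: iP.
Qed.

Lemma ranklike_mono phi : ranklike phi -> forall I J : {set 'I_5}, I \subset J -> (phi I <= phi J)%N.
Proof.
case=> _ _ _ phiU _ I J; have [n] := ubnP #|J|; elim: n J => // n IH J.
rewrite ltnS => Jn IJ; have [->//|] := eqVneq I J.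
rewrite eqEsubset IJ /= => /subsetPn[x xJ xI].
have /andP[+ _] := phiU x (J :\ x); rewrite setD1K //; apply: leq_trans.
apply: IH; last by apply/subsetD1P.
by move: Jn; rewrite (cardsD1 x J) xJ.
Qed.

(** * Flats, face degenerations and short chains of degenerations *)

Definition flat (phi : setfun 'I_5) (J : {set 'I_5}) : Prop :=
  forall i, i \notin J -> (phi J < phi (i |: J))%N.

(** A larger set of the same rank would contain a point outside [J], and adding this point to [J]
    already raises the rank. *)
Lemma flat_face phi J : ranklike phi -> flat phi J -> is_face phi (phi J) J.
Proof.
move=> rphi fJ; apply/maxsetP; split=> // I /eqP EI JI.
apply/eqP; rewrite eqEsubset JI andbT; apply/subsetP => i iI; apply/negPn/negP => iJ.
have := fJ i iJ; rewrite ltnNge -EI ranklike_mono //.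
by rewrite subUset sub1set iI.
Qed.

Definition flatc (f : seq nat) (J : N) : bool :=
  allb (fun i => if mem_mask J i then true else (get f J < get f (N.lor (bit i) J))%N) ords.

Lemma flatcP phi J : flatc (code phi) J -> flat phi (msk J).
Proof.
move/allbP => h i; rewrite inE => /negbTE iJ; have := h i (mem_ords i).
by rewrite iJ !getE msk_lor msk_bit.
Qed.

(** The rank function of the direct sum of the restriction to [J] and the contraction of [J]. *)
Definition face (phi : setfun 'I_5) (J : {set 'I_5}) : setfun 'I_5 :=
  [ffun I => phi (I :|: J) + phi (I :&: J) - phi J]%N.

Definition facec (f : seq nat) (J : N) : seq nat :=
  [seq get f (N.lor k J) + get f (N.land k J) - get f J | k <- masks]%N.

Lemma code_face phi J : code (face phi (msk J)) = facec (code phi) J.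
Proof. by apply: eq_map => I; rewrite ffunE !getE msk_lor msk_land. Qed.

Lemma faceE phi J I : ranklike phi -> (face phi J I + phi J = phi (I :|: J) + phi (I :&: J))%N.
Proof.
move=> rphi; rewrite ffunE subnK //.
by apply: leq_trans (leq_addr _ _); apply: ranklike_mono => //; apply: subsetUr.
Qed.

Definition blkc (g f : seq nat) : bool :=
  if lec g f then
    let Ps := comps f in
    if allb (fun B => allb (fun I => get g (N.land I B) == get f (N.land I B)) masks) Ps
    then rhoc f Ps else false
  else false.

Lemma blkcP psi phi : blkc (code psi) (code phi) -> block_degeneration psi phi.
Proof.
rewrite /blkc; case: lecP => // le; case: allbP => // h rP; split=> //.
exists (blocks (comps (code phi))); first exact: rhocP.
move=> B /mem_blocks[k kP ->] I Ik; have /allbP/(_ _ (idx_masks I)) := h k kP.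
by rewrite !getE msk_land idxK; move/setIidPl: Ik => -> /eqP.
Qed.

Definition prec_shape (psi phi : setfun 'I_5) : Prop :=
  exists P, [/\ rho_partition phi P, rho_partition psi P & exists2 B, B \in P & (psi B < phi B)%N].

Definition precc (g f : seq nat) : bool :=
  let Ps := comps f in
  if hasb (fun B => get g B < get f B)%N Ps then
    if comps g == Ps then rhoc f Ps && rhoc g Ps else false
  else false.

Lemma preccP psi phi : precc (code psi) (code phi) -> prec_shape psi phi.
Proof.
rewrite /precc; case: hasbP => // -[B BP Blt]; case: eqP => // _ /andP[r1 r2].
exists (blocks (comps (code phi))); split; [exact: rhocP..|].
by exists (msk B); [apply/mem_blocks; exists B | rewrite -!getE].
Qed.

Definition reach1 (psi phi : setfun 'I_5) : Prop := psi = phi \/ block_degeneration psi phi.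

Definition reach1c (g f : seq nat) : bool := if g == f then true else blkc g f.

Lemma reach1cP psi phi : reach1c (code psi) (code phi) -> reach1 psi phi.
Proof. by rewrite /reach1c; case: eqP => [/code_inj|_ /blkcP]; [left | right]. Qed.

(** The short chains that suffice below a wild [phi]. Since [setT] is flat and
    [face phi setT = phi], block degenerations of [phi] itself are included. *)
Definition reach (psi phi : setfun 'I_5) : Prop :=
  [\/ psi = phi, prec_shape psi phi,
      exists2 J, flat phi J & reach1 psi (face phi J) |
      exists2 J, flat phi J & exists2 J', flat (face phi J) J' &
        reach1 psi (face (face phi J) J')].

Definition reachc (g f : seq nat) : bool :=
  if g == f then true else if precc g f then true else
  let Js := [seq J <- masks | flatc f J] in
  if hasb (fun J => reach1c g (facec f J)) Js then true else
  hasb (fun J => let h := facec f J in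
    hasb (fun J' => if flatc h J' then reach1c g (facec h J') else false) masks) Js.

Lemma reachcP psi phi : reachc (code psi) (code phi) -> reach psi phi.
Proof.
rewrite /reachc; case: eqP => [/code_inj ->|_]; first by constructor 1.
case: ifP => [/preccP|_]; first by constructor 2.
case: hasbP => [[J]|_].
  rewrite mem_filter => /andP[/flatcP fJ _]; rewrite -code_face => /reach1cP r _.
  by constructor 3; exists (msk J).
case/hasbP => J; rewrite mem_filter => /andP[/flatcP fJ _] /hasbP[J' _].
rewrite -code_face; case: ifP => // /flatcP fJ'; rewrite -code_face => /reach1cP r.
by constructor 4; exists (msk J) => //; exists (msk J').
Qed.

(* Bipartite fundamental graph of the basis [b]: [i] outside [b] and [j] in [b]
   are joined when exchanging them gives another basis. *)
Definition exch (phi : setfun 'I_5) (b : {set 'I_5}) (i j : 'I_5) : bool :=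
  [&& i \notin b, j \in b & phi (i |: b :\ j) == phi b].

Definition adj phi b i j := exch phi b i j || exch phi b j i.

(* An elimination order showing that the graph has no cycle. *)
Fixpoint forest phi b (p : seq 'I_5) : bool :=
  if p is v :: p' then (count (adj phi b v) p' <= 1)%N && forest phi b p' else true.

Definition exchc (f : seq nat) (b : N) (i j : 'I_5) : bool :=
  if mem_mask b i then false else
  if mem_mask b j then get f (N.lor (bit i) (clear b j)) == get f b else false.

Definition adjc f b i j := if exchc f b i j then true else exchc f b j i.

Fixpoint forestc f b (p : seq 'I_5) : bool :=
  if p is v :: p' then if (count (adjc f b v) p' <= 1)%N then forestc f b p' else false else true.

Fixpoint inserts (T : Type) (x : T) (s : seq T) : seq (seq T) :=
  if s is y :: s' then (x :: s) :: [seq y :: t | t <- inserts x s'] else [:: [:: x]].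

Definition perms5 : seq (seq 'I_5) :=
  Eval vm_compute in foldr (fun x ss => flatten [seq inserts x s | s <- ss]) [:: [::]] ords.

Definition tamec (f : seq nat) : bool :=
  hasb (fun b => if get f b == pc b then if get f b == get f 31 then hasb (forestc f b) perms5
                 else false else false) masks.

Definition tame (phi : setfun 'I_5) : bool := tamec (code phi).

Lemma exchcE phi b i j : exchc (code phi) b i j = exch phi (msk b) i j.
Proof.
rewrite /exchc /exch !inE; case: (mem_mask b i) => //; case: (mem_mask b j) => //.
by rewrite !getE msk_lor msk_bit msk_clear.
Qed.

Lemma adjcE phi b i j : adjc (code phi) b i j = adj phi (msk b) i j.
Proof. by rewrite /adjc /adj !exchcE; case: ifP. Qed.

Lemma forestcE phi b p : forestc (code phi) b p = forest phi (msk b) p.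
Proof.
elim: p => //= v p ->; rewrite (eq_count (a2 := adj phi (msk b) v)); first by case: ifP.
by move=> i; apply: adjcE.
Qed.

Lemma tameP phi : tame phi -> exists (b : {set 'I_5}) (p : seq 'I_5),
  [/\ #|b| = phi b, phi b = phi setT, uniq p, (forall i, i \in p) & forest phi b p].
Proof.
have pP : all (fun p => uniq p && all (fun i => i \in p) ords) perms5 by vm_compute.
case/hasbP => b _; case: eqP => // cb; case: eqP => // rb /hasbP[p /(allP pP)/andP[up mp] fp].
exists (msk b), p; rewrite card_msk -cb -msk31 -!getE rb; split=> //; last by rewrite -forestcE.
by move=> i; apply: (allP mp); apply: mem_ords.
Qed.

(* A rank function is wild (not tame) when its stratum consists of infinitely many orbits. *)
Definition wilds := Eval vm_compute in [seq f <- matroids | ~~ tamec f].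

Lemma wild_code phi : ranklike phi -> ~~ tame phi -> code phi \in wilds.
Proof.
have -> : wilds = [seq f <- matroids | ~~ tamec f] by vm_cast_no_check (erefl wilds).
by move=> r w; rewrite mem_filter w; apply: code_matroid.
Qed.

(* Minors of type U_{2,4}: the four points [s] seen from the apex [e], or, if [e = None],
   the four points themselves. *)
Definition eset (e : option 'I_5) (s : seq 'I_5) : {set 'I_5} := [set i | (Some i == e) || (i \in s)].

Definition rk2 (e : option 'I_5) : nat := (isSome e).+2.

Definition bas phi e a b : bool := phi (eset e [:: a; b]) == rk2 e.

Definition U24 phi e a b c d : bool :=
  [&& phi (eset e [:: a; b; c; d]) == rk2 e, bas phi e a b, bas phi e c d, bas phi e a c,
      bas phi e b d, bas phi e a d & bas phi e b c].

Definition emask (e : option 'I_5) (s : seq 'I_5) : N :=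
  foldr (fun i k => N.lor (bit i) k) (if e is Some i then bit i else 0%num) s.

Lemma msk_emask e s : msk (emask e s) = eset e s.
Proof.
elim: s => [|x s IH].
  by rewrite /emask /=; apply/setP => i; case: e => [j|]; rewrite ?msk_bit ?msk0 !inE ?orbF.
by rewrite /emask -/(emask e s) msk_lor IH msk_bit; apply/setP => i; rewrite !inE orbCA.
Qed.

Definition basc f e a b : bool := get f (emask e [:: a; b]) == rk2 e.

Definition U24c f e a b c d : bool :=
  if get f (emask e [:: a; b; c; d]) == rk2 e then
  [&& basc f e a b, basc f e c d, basc f e a c, basc f e b d, basc f e a d & basc f e b c] else false.

Lemma bascE phi e a b : basc (code phi) e a b = bas phi e a b.
Proof. by rewrite /basc getE msk_emask. Qed.

Lemma U24cE phi e a b c d : U24c (code phi) e a b c d = U24 phi e a b c d.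
Proof. by rewrite /U24c getE msk_emask !bascE /U24; case: ifP. Qed.

(** The last entry of each permutation is the apex or, for [None], the point left out. *)
Definition quads : seq (option 'I_5 * seq 'I_5) :=
  Eval vm_compute in
  flatten [seq [seq (e, take 4 p) | p <- perms5 & (Some (last ord0 p) == e) || (e == None)]
          | e <- None :: map Some ords].

(* The three products of brackets attached to a [U_{2,4}] minor are nonzero multiples of one
   another on an orbit closure, hence they vanish simultaneously. *)
Definition Ncond (phi psi : setfun 'I_5) : Prop :=
  forall e a b c d, U24 phi e a b c d ->
    bas psi e a b && bas psi e c d = bas psi e a c && bas psi e b d.

Definition quadc (F : option 'I_5 -> 'I_5 -> 'I_5 -> 'I_5 -> 'I_5 -> bool)
    (q : option 'I_5 * seq 'I_5) : bool :=
  if q is (e, [:: a; b; c; d]) then F e a b c d else false.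

Definition Nc (qs : seq (option 'I_5 * seq 'I_5)) (g : seq nat) : bool :=
  allb (quadc (fun e a b c d =>
    basc g e a b && basc g e c d == basc g e a c && basc g e b d)) qs.

Definition quadsof (f : seq nat) := [seq q <- quads | quadc (U24c f) q].

Lemma NcP phi psi : Ncond phi psi -> Nc (quadsof (code phi)) (code psi).
Proof.
move=> h; apply/allbP => q; rewrite /quadsof mem_filter => /andP[+ _].
case: q => e [|a [|b [|c [|d [|]]]]] //= q.
by rewrite !bascE; apply/eqP/h; rewrite -U24cE.
Qed.

Definition below (f : seq nat) : seq (seq nat) :=
  let qs := quadsof f in [seq g <- matroids | if lec g f then Nc qs g else false].

Lemma below_code phi psi : ranklike psi -> setfun_le psi phi -> Ncond phi psi ->
  code psi \in below (code phi).
Proof.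
move=> r le N; rewrite /below mem_filter code_matroid // andbT.
by case: lecP => // _; apply: NcP.
Qed.

Lemma allb2P (F : seq nat -> seq (seq nat)) (P : seq nat -> seq nat -> bool) :
  allb (fun f => allb (P f) (F f)) wilds -> forall f g, f \in wilds -> g \in F f -> P f g.
Proof. by move=> /allbP h f g fw gF; apply: (allbP _ _ (h f fw)). Qed.

(** A finite check over the pairs in the enumeration. It turns the conditions that hold on an orbit
    closure into a chain of degenerations, so it is the combinatorial half of the description of the
    strata met by the closure. *)
Lemma reach_below phi psi : ranklike phi -> ranklike psi -> ~~ tame phi ->
  setfun_le psi phi -> Ncond phi psi -> reach psi phi.
Proof.
move=> rphi rpsi w le N.
have H : allb (fun f => allb (fun g => reachc g f) (below f)) wilds by vm_cast_no_check (erefl true).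
by apply/reachcP/(allb2P H); [apply: wild_code | apply: below_code].
Qed.

(* Replacing the vector of [d] by its sum with a general multiple of that of [c] does not
   change [phi]. *)
Definition freeto (phi : setfun 'I_5) (d c : 'I_5) : Prop :=
  forall I : {set 'I_5}, d \notin I -> phi (d |: I) = phi I -> phi (c |: I) = phi I.

Definition freetoc (f : seq nat) (d c : 'I_5) : bool :=
  allb (fun I => if mem_mask I d then true else
                 if get f (N.lor (bit d) I) == get f I then get f (N.lor (bit c) I) == get f I
                 else true) masks.

Lemma freetocP phi d c : freetoc (code phi) d c -> freeto phi d c.
Proof.
move=> /allbP h I dI E; have := h _ (idx_masks I).
have -> : mem_mask (idx I) d = false by apply/negbTE; move: dI; rewrite -{1}[I]idxK inE.
by rewrite !getE !(msk_lor (bit _)) !msk_bit idxK E eqxx => /eqP.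
Qed.

(** A finite check as well. In the second case the common minor has a cross-ratio that varies inside
    the stratum of [psi] but is prescribed on the orbit closure. *)
Lemma wild_below phi psi : ranklike phi -> ranklike psi -> ~~ tame phi -> ~~ tame psi ->
  setfun_le psi phi -> Ncond phi psi ->
  prec_shape psi phi \/
  exists e a b c d, [/\ U24 phi e a b c d, U24 psi e a b c d & freeto psi d c].
Proof.
move=> rphi rpsi w w' le N.
have H : allb (fun f => allb (fun g => if tamec g then true else
   if precc g f then true else
   hasb (quadc (fun e a b c d => if U24c f e a b c d then if U24c g e a b c d then freetoc g d c
                                 else false else false)) quads) (below f)) wilds
  by vm_cast_no_check (erefl true).
have := allb2P H (wild_code rphi w) (below_code rpsi le N) => {H}.
rewrite -/(tame psi) (negbTE w'); case: ifP => [/preccP p|_]; first by left.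
case/hasbP => q _; case: q => e [|a [|b [|c [|d [|]]]]] //.
rewrite /quadc !U24cE; case: ifP => // u; case: ifP => // u' /freetocP fr.
by right; exists e, a, b, c, d.
Qed.

(** Five distinct points of a plane, any four of which span it. *)
Definition simple_big (phi : setfun 'I_5) : Prop :=
  [/\ phi setT = 3, forall i j, i != j -> phi [set i; j] = 2 & forall i, phi (~: [set i]) = 3].

Definition simple_bigc (f : seq nat) : bool :=
  if get f 31 == 3 then
    if allb (fun i => allb (fun j => if i == j then true else get f (N.lor (bit i) (bit j)) == 2) ords) ords
    then allb (fun i => get f (N.ldiff 31 (bit i)) == 3) ords else false
  else false.

Lemma simple_bigcP phi : simple_bigc (code phi) -> simple_big phi.
Proof.
rewrite /simple_bigc; case: eqP => // E3; case: allbP => // E2 /allbP E4; split.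
- by move: E3; rewrite getE msk31.
- move=> i j /negbTE ij; have /allbP/(_ j (mem_ords j)) := E2 i (mem_ords i).
  by rewrite ij getE msk_lor !msk_bit => /eqP.
- by move=> i; have /eqP := E4 i (mem_ords i); rewrite getE msk_ldiff msk31 msk_bit setTD.
Qed.

(** The enumeration leaves two ways to reach the whole stratum of [psi]: project a plane
    configuration to rank 2, or pass through a tame face degeneration, whose stratum is a single
    orbit. *)
Lemma wild_prec phi psi B : ranklike phi -> ranklike psi -> ~~ tame phi -> setfun_le psi phi ->
  B != set0 -> separator phi B -> ~~ decomposable phi B -> separator psi B -> (psi B < phi B)%N ->
  (simple_big phi /\ (psi setT <= 2)%N) \/
  exists J, [/\ flat phi J, tame (face phi J) & setfun_le psi (face phi J)].
Proof.
move=> rphi rpsi w le B0 sphi dphi spsi lt.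
have H : allb (fun f => let hs := [seq h <- [seq facec f J | J <- masks & flatc f J] | tamec h] in
    let big := simple_bigc f in
    let Bs := [seq B <- masks | if pc B == 0 then false else if sepc f B then ~~ decc f B else false] in
    allb (fun g => if lec g f then
      if hasb (fun B => if get g B < get f B then sepc g B else false)%N Bs then
        if (if big then get g 31 <= 2 else false)%N then true else hasb (lec g) hs
      else true else true) matroids) wilds by vm_cast_no_check (erefl true).
have := allbP _ _ H _ (wild_code rphi w) => {H} /allbP/(_ _ (code_matroid rpsi)).
case: lecP => // _; case: hasbP => [_|[]]; last first.
  exists (idx B); last by rewrite !get_idx lt; apply/sepcP; rewrite idxK.
  rewrite mem_filter idx_masks -card_msk -deccP idxK cards_eq0 (negbTE B0) dphi andbT.
  by case: sepcP => //; rewrite idxK.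
case: ifP => [|_ /hasbP[h]].
  case: ifP => // /simple_bigcP big; rewrite getE msk31; by left.
rewrite mem_filter => /andP[t /mapP[J]]; rewrite mem_filter => /andP[/flatcP fJ _] hE.
rewrite hE -code_face in t * => /lecP le'.
by right; exists (msk J).
Qed.

(** The hypothesis on blocks says that [psi] and [phi] agree on each block of rho. Apart from
    equality, the enumeration leaves only four points of rank 2 and a fifth point that moves into
    their span. *)
Lemma wild_block phi psi : ranklike phi -> ranklike psi -> ~~ tame phi -> setfun_le psi phi ->
  (forall i, exists B : {set 'I_5}, [/\ i \in B, separator phi B, ~~ decomposable phi B
     & forall I : {set 'I_5}, I \subset B -> psi I = phi I]) ->
  psi = phi \/ exists i, [/\ phi (~: [set i]) = 2, phi setT = 3, psi setT = 2
                          & forall I : {set 'I_5}, i \notin I -> psi I = phi I].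
Proof.
move=> rphi rpsi w le h.
have H : allb (fun f =>
    let Bs := [seq B <- masks | if sepc f B then ~~ decc f B else false] in
    allb (fun g => if lec g f then
      if allb (fun i => hasb (fun B => if mem_mask B i then
           allb (fun k => get g (N.land k B) == get f (N.land k B)) masks else false) Bs) ords
      then if g == f then true else
        hasb (fun i => if get f (N.ldiff 31 (bit i)) == 2 then if get f 31 == 3 then if get g 31 == 2 then
          allb (fun k => if mem_mask k i then true else get g k == get f k) masks else false else false else false) ords
      else true else true) matroids) wilds by vm_cast_no_check (erefl true).
have := allbP _ _ H _ (wild_code rphi w) => {H} /allbP/(_ _ (code_matroid rpsi)).
case: lecP => // _; case: allbP => [_|[]]; last first.
  move=> i _; have [B [iB sB dB EB]] := h i; apply/hasbP; exists (idx B).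
    rewrite mem_filter idx_masks -deccP idxK dB andbT.
    by case: sepcP => //; rewrite idxK.
  move: iB; rewrite -{1}[B]idxK inE => ->; apply/allbP => k _.
  by rewrite !getE msk_land idxK EB // subsetIr.
case: eqP => [/code_inj -> _|_ /hasbP[i _]]; first by left.
case: eqP => // E1; case: eqP => // E0; case: eqP => // E2 /allbP E3; right; exists i; split.
- by move: E1; rewrite getE msk_ldiff msk31 msk_bit setTD.
- by move: E0; rewrite getE msk31.
- by move: E2; rewrite getE msk31.
- move=> I; rewrite -{1}[I]idxK inE => /negbTE iI; have := E3 _ (idx_masks I).
  by rewrite iI !get_idx => /eqP.
Qed.

Lemma pairs_rank1 phi (I : {set 'I_5}) : ranklike phi ->
  (forall a b, a \in I -> b \in I -> phi [set a; b] <= 1)%N -> (phi I <= 1)%N.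
Proof.
move=> rphi h.
have H : allb (fun f => allb (fun k => if get f k <= 1 then true else
    hasb (fun a => if mem_mask k a then hasb (fun b => if mem_mask k b then 1 < get f (N.lor (bit a) (bit b)) else false) ords
      else false) ords) masks)%N matroids by vm_cast_no_check (erefl true).
have := allbP _ _ H _ (code_matroid rphi) => {H} /allbP/(_ _ (idx_masks I)).
rewrite get_idx; case: ifP => // _ /hasbP[a _]; case: ifP => // aI /hasbP[b _]; case: ifP => // bI.
rewrite getE msk_lor !msk_bit ltnNge h //.
- by rewrite -[I]idxK inE.
- by rewrite -[I]idxK inE.
Qed.

(* [phi] is the largest rank function with total rank [phi setT], with [S] of rank [phi S],
   and with the parallel classes given by their representatives [r i]. *)
Definition flag_form (phi : setfun 'I_5) (S : {set 'I_5}) (r : 'I_5 -> 'I_5) : Prop :=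
  [/\ forall i, (phi [set i; r i] <= 1)%N, forall i, (r i \in S) = (i \in S)
    & forall I : {set 'I_5}, (minn (phi setT) (minn (phi S) #|r @: (I :&: S)| + #|r @: (I :\: S)|) <= phi I)%N].

(* Two 3-point lines meeting in the point [a]. *)
Definition cross_form (phi : setfun 'I_5) (a b c d e : 'I_5) : Prop :=
  [/\ uniq [:: a; b; c; d; e], phi [set a; b; c] <= 2, phi [set a; d; e] <= 2
    & forall I : {set 'I_5}, minn (if (I \subset [set a; b; c]) || (I \subset [set a; d; e]) then 2 else 3) #|I| <= phi I]%N.

Definition imgc (r : seq 'I_5) (k : N) : N :=
  foldr (fun i m => if mem_mask k i then N.lor (bit (nth ord0 r i)) m else m) 0%num ords.

Lemma msk_imgc r k : msk (imgc r k) = ((fun i : 'I_5 => nth ord0 r i) @: msk k)%SET.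
Proof.
have E s j : (j \in msk (foldr (fun i m => if mem_mask k i then N.lor (bit (nth ord0 r i)) m else m) 0%num s))
    = has (fun i : 'I_5 => mem_mask k i && (j == nth ord0 r i)) s.
  elim: s => [|i s IH] /=; first by rewrite msk0 inE.
  by case: ifP => _; rewrite ?(msk_lor (bit _)) ?in_setU IH // msk_bit inE.
apply/setP => j; rewrite E; apply/hasP/imsetP => [[i _ /andP[ki /eqP ->]]|[i + ->]].
  by exists i; rewrite // inE.
by rewrite inE => ki; exists i; rewrite ?mem_ords // ki eqxx.
Qed.

(** The least element parallel to [i]. The filtered list contains [i] itself for a loopless matroid,
    so the default [ord0] is not reached. *)
Definition classc (f : seq nat) : seq 'I_5 :=
  [seq head ord0 [seq j <- ords | get f (N.lor (bit i) (bit j)) <= 1]%N | i <- ords].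

(** Both forms admit a parametrization by matrix or vector factors ranging over linear spaces, which
    is what interpolation requires. The enumeration shows that they exhaust all cases. *)
Lemma param phi : ranklike phi ->
  (exists S r, flag_form phi S r) \/ (exists a b c d e, cross_form phi a b c d e).
Proof.
move=> rphi.
have H : allb (fun f =>
   if hasb (fun S =>
        if allb (fun i : 'I_5 => mem_mask S (nth ord0 (classc f) i) == mem_mask S i) ords then
          if allb (fun i : 'I_5 => get f (N.lor (bit i) (bit (nth ord0 (classc f) i))) <= 1) ords then
          allb (fun k => minn (get f 31) (minn (get f S) (pc (imgc (classc f) (N.land k S))) + pc (imgc (classc f) (N.ldiff k S))) <= get f k) masks
          else false else false) masks then true
   else hasb (fun p => if p is [:: a; b; c; d; e] then
      let A := N.lor (N.lor (bit a) (bit b)) (bit c) in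
      let B := N.lor (N.lor (bit a) (bit d)) (bit e) in
      if get f A <= 2 then if get f B <= 2 then
      allb (fun k => minn (if (pc (N.ldiff k A) == 0) || (pc (N.ldiff k B) == 0) then 2 else 3) (pc k) <= get f k) masks
      else false else false else false) perms5)%N matroids by vm_cast_no_check (erefl true).
have := allbP _ _ H _ (code_matroid rphi) => {H}.
set r := classc _; case: ifP => [/hasbP[S _]|_].
  case: ifP => // /allbP h1; case: ifP => // /allbP h2 /allbP h3 _; left.
  exists (msk S), (fun i => nth ord0 r i); split.
  - by move=> i; have := h2 i (mem_ords i); rewrite getE msk_lor !msk_bit.
  - by move=> i; have /eqP := h1 i (mem_ords i); rewrite !inE.
  - move=> I; have := h3 _ (idx_masks I).
    by rewrite !getE -!card_msk !msk_imgc msk_land msk_ldiff idxK msk31.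
case/hasbP => p pP; have uP : all uniq perms5 by vm_compute.
move: (allP uP p pP) => {uP pP}; case: p => [|a [|b [|c [|d [|e [|]]]]]] // up; lazy beta zeta.
case: ifP => // h1; case: ifP => // h2 /allbP h3; right; exists a, b, c, d, e; split=> //.
- by move: h1; rewrite getE !msk_lor !msk_bit.
- by move: h2; rewrite getE !msk_lor !msk_bit.
- move=> I; have := h3 _ (idx_masks I).
  rewrite -!card_msk !msk_ldiff get_idx !idxK !msk_lor !msk_bit.
  by rewrite !cards_eq0 !setD_eq0.
Qed.

Import GRing.Theory.
Local Open Scope ring_scope.

(** * Row spaces and polynomial curves *)

Section RankFunction.
Variable F : fieldType.
Implicit Types M N : 'M[F]_(5, 4).

Definition sp M (I : {set 'I_5}) : 'M[F]_4 := (\sum_(i in I) <<row i M>>)%MS.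

Definition mrk M : setfun 'I_5 := [ffun I => \rank (sp M I)].

Lemma sp_subP m M (I : {set 'I_5}) (W : 'M_(m, 4)) :
  reflect (forall i, i \in I -> (row i M <= W)%MS) (sp M I <= W)%MS.
Proof. by apply: (iffP sumsmx_subP) => h i /h; rewrite genmxE. Qed.

Lemma row_sp M (I : {set 'I_5}) i : i \in I -> (row i M <= sp M I)%MS.
Proof. by move=> iI; apply: (sp_subP M I (sp M I) _). Qed.

Lemma spS M (I J : {set 'I_5}) : I \subset J -> (sp M I <= sp M J)%MS.
Proof. by move=> /subsetP IJ; apply/sp_subP => i /IJ; apply: row_sp. Qed.

Lemma spU M I J : (sp M (I :|: J) :=: sp M I + sp M J)%MS.
Proof.
apply/eqmxP; apply/andP; split; last by rewrite addsmx_sub !spS ?subsetUl ?subsetUr.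
apply/sp_subP => i /setUP[] h; apply: submx_trans (row_sp M h) _.
  exact: addsmxSl.
exact: addsmxSr.
Qed.

Lemma sp1 M i : (sp M [set i] :=: row i M)%MS.
Proof. by rewrite /sp big_set1; apply: genmxE. Qed.

Lemma spU1 M i I : (sp M (i |: I) :=: row i M + sp M I)%MS.
Proof. by apply: eqmx_trans (spU M _ _) (adds_eqmx (sp1 M i) (eqmx_refl _)). Qed.

Lemma sp2 M i j : (sp M [set i; j] :=: row i M + row j M)%MS.
Proof. by apply: eqmx_trans (spU1 M _ _) (adds_eqmx (eqmx_refl _) (sp1 M j)). Qed.

Lemma mrkE M I : mrk M I = \rank (sp M I).
Proof. by rewrite ffunE. Qed.

Lemma mrk_le_sub M N (I J : {set 'I_5}) : (sp M I <= sp N J)%MS -> (mrk M I <= mrk N J)%N.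
Proof. by rewrite !mrkE; apply: mxrankS. Qed.

Lemma mrk_mono M (I J : {set 'I_5}) : I \subset J -> (mrk M I <= mrk M J)%N.
Proof. by move=> IJ; apply: mrk_le_sub; apply: spS. Qed.

Lemma mrkU M I J : (mrk M (I :|: J) + mrk M (I :&: J) <= mrk M I + mrk M J)%N.
Proof.
rewrite !mrkE (spU M I J) -(mxrank_sum_cap (sp M I)) leq_add2l mxrankS //.
by rewrite sub_capmx !spS ?subsetIl ?subsetIr.
Qed.

Lemma mrk0 M : mrk M set0 = 0%N.
Proof. by rewrite mrkE /sp big_set0 mxrank0. Qed.

Lemma mrk_card M I : (mrk M I <= #|I|)%N.
Proof.
rewrite mrkE; apply: leq_trans (mxrank_sum_leqif _) _ => /=.
rewrite -sum1_card; apply: leq_sum => i _; rewrite mxrank_gen; exact: rank_leq_row.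
Qed.

Lemma mrk_U1 M i I : (mrk M I <= mrk M (i |: I) <= (mrk M I).+1)%N.
Proof.
rewrite mrk_mono ?subsetUr //= -[X in (_ <= X)%N]add1n.
have := mrkU M [set i] I; have := mrk_card M [set i]; rewrite cards1 => h1 h2.
by apply: leq_trans (leq_trans (leq_addr _ _) h2) _; rewrite leq_add2r.
Qed.

Lemma mrk_ranklike M : (forall i, row i M != 0) -> ranklike (mrk M).
Proof.
move=> nz; split.
- exact: mrk0.
- by move=> i; rewrite mrkE sp1 rank_rV nz.
- by move=> I; rewrite mrkE; apply: rank_leq_row.
- by move=> i I; apply: mrk_U1.
- by move=> I J; apply: mrkU.
Qed.

Lemma mrk_mem M i I : (mrk M (i |: I) == mrk M I) = (row i M <= sp M I)%MS.
Proof.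
rewrite !mrkE spU1 eq_sym (mxrank_leqif_sup (addsmxSr _ _)).2.
by rewrite addsmx_sub submx_refl andbT.
Qed.

End RankFunction.

(** * Polynomial functions, polynomial curves of matrices and semicontinuity of rank *)

Section PolyFun.
Variable F : fieldType.

Definition polyf (h : F -> F) : Prop := exists p : {poly F}, forall t, h t = p.[t].

Lemma polyf_cst a : polyf (fun _ => a).
Proof. by exists a%:P => t; rewrite hornerC. Qed.

Lemma polyf_id : polyf id.
Proof. by exists 'X => t; rewrite hornerX. Qed.

Lemma polyf_add f g : polyf f -> polyf g -> polyf (fun t => f t + g t).
Proof. by case=> p pE [q qE]; exists (p + q) => t; rewrite hornerD pE qE. Qed.

Lemma polyf_mul f g : polyf f -> polyf g -> polyf (fun t => f t * g t).
Proof. by case=> p pE [q qE]; exists (p * q) => t; rewrite hornerM pE qE. Qed.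

Lemma polyf_sum (I : Type) (r : seq I) (P : pred I) (f : I -> F -> F) :
  (forall i, polyf (f i)) -> polyf (fun t => \sum_(i <- r | P i) f i t).
Proof.
move=> h; elim: r => [|i r [p pE]]; first by exists 0 => t; rewrite big_nil horner0.
have [q qE] := h i; exists (if P i then q + p else p) => t.
by rewrite big_cons; case: ifP; rewrite ?hornerD pE ?qE.
Qed.

Lemma polyf_prod (I : Type) (r : seq I) (P : pred I) (f : I -> F -> F) :
  (forall i, polyf (f i)) -> polyf (fun t => \prod_(i <- r | P i) f i t).
Proof.
move=> h; elim: r => [|i r [p pE]]; first by exists 1 => t; rewrite big_nil hornerC.
have [q qE] := h i; exists (if P i then q * p else p) => t.
by rewrite big_cons; case: ifP; rewrite ?hornerM pE ?qE.
Qed.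

Lemma polyf_ext f g : f =1 g -> polyf f -> polyf g.
Proof. by move=> E [p pE]; exists p => t; rewrite -E. Qed.

Definition pmx m n (A : F -> 'M[F]_(m, n)) : Prop := forall i j, polyf (fun t => A t i j).

Lemma pmx_cst m n (A : 'M[F]_(m, n)) : pmx (fun _ => A).
Proof. by move=> i j; apply: polyf_cst. Qed.

Lemma pmx_add m n (A B : F -> 'M[F]_(m, n)) : pmx A -> pmx B -> pmx (fun t => A t + B t).
Proof.
by move=> pA pB i j; apply: polyf_ext (polyf_add (pA i j) (pB i j)) => t; rewrite mxE.
Qed.

Lemma pmx_mul m n p (A : F -> 'M[F]_(m, n)) (B : F -> 'M[F]_(n, p)) :
  pmx A -> pmx B -> pmx (fun t => A t *m B t).
Proof.
move=> pA pB i j; apply: (@polyf_ext (fun t => \sum_k A t i k * B t k j)).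
  by move=> t; rewrite mxE.
by apply: polyf_sum => k; apply: polyf_mul.
Qed.

Lemma pmx_scale m n (f : F -> F) (A : F -> 'M[F]_(m, n)) :
  polyf f -> pmx A -> pmx (fun t => f t *: A t).
Proof.
by move=> pf pA i j; apply: polyf_ext (polyf_mul pf (pA i j)) => t; rewrite mxE.
Qed.

Lemma polyf_det n (A : F -> 'M[F]_n) : pmx A -> polyf (fun t => \det (A t)).
Proof.
move=> pA; apply: polyf_sum => s; apply: polyf_mul; first exact: polyf_cst.
by apply: polyf_prod => i; apply: pA.
Qed.

Definition itp m n (A B : 'M[F]_(m, n)) (t : F) : 'M[F]_(m, n) := A + t *: (B - A).

Lemma itp0 m n (A B : 'M[F]_(m, n)) : itp A B 0 = A.
Proof. by rewrite /itp scale0r addr0. Qed.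

Lemma itp1 m n (A B : 'M[F]_(m, n)) : itp A B 1 = B.
Proof. by rewrite /itp scale1r addrC subrK. Qed.

Lemma pmx_itp m n (A B : 'M[F]_(m, n)) : pmx (itp A B).
Proof.
apply: pmx_add; first exact: pmx_cst.
by apply: pmx_scale; [exact: polyf_id | exact: pmx_cst].
Qed.

Lemma rank_factor m n s (X : 'M[F]_(m, n)) : (\rank X <= s)%N ->
  exists (A : 'M_(m, s)) (P : 'M_(s, n)), X = A *m P.
Proof.
(* The factorization through dimension [\rank X] is padded with zeros up to [s]. *)
move=> h; exists (col_base X *m pid_mx (\rank X)), (pid_mx (\rank X) *m row_base X).
by rewrite mulmxA -(mulmxA (col_base X)) pid_mx_id // pid_mx_1 mulmx1 mulmx_base.
Qed.

(** This replaces the choice of a nonvanishing minor: with [X] and [Y] fixed, the determinant of the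
    product is polynomial in the matrix and equals 1 at [A]. *)
Lemma rank_witness m n (A : 'M[F]_(m, n)) :
  exists (X : 'M_(\rank A, m)) (Y : 'M_(n, \rank A)), X *m A *m Y = 1%:M.
Proof.
exists (pinvmx (col_base A)), (pinvmx (row_base A)).
rewrite -[X in _ *m X *m _](mulmx_base A) mulmxA mulVpmx ?col_base_full // mul1mx.
by rewrite mulmxVp ?row_base_free.
Qed.

(** Zeroing the rows outside [I] keeps the format of the matrix and is linear in [A], so the rank of
    a subfamily can be followed along a curve. *)
Definition mk m n (I : {set 'I_m}) (A : 'M[F]_(m, n)) : 'M[F]_(m, n) :=
  diag_mx (\row_i (i \in I)%:R) *m A.

Lemma row_mk m n (I : {set 'I_m}) (A : 'M[F]_(m, n)) i :
  row i (mk I A) = (i \in I)%:R *: row i A.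
Proof. by rewrite /mk row_mul row_diag_mx -scalemxAl -rowE mxE. Qed.

Lemma pmx_mk m n (I : {set 'I_m}) (A : F -> 'M[F]_(m, n)) : pmx A -> pmx (fun t => mk I (A t)).
Proof. by move=> pA; apply: pmx_mul => //; apply: pmx_cst. Qed.

Lemma mk_sp (M : 'M[F]_(5, 4)) I : (mk I M :=: sp M I)%MS.
Proof.
apply/eqmxP; apply/andP; split.
  apply/row_subP => i; rewrite row_mk; case: (boolP (i \in I)) => iI.
    by rewrite scale1r row_sp.
  by rewrite scale0r sub0mx.
apply/sp_subP => i iI; rewrite -[row i M]scale1r.
by have := row_sub i (mk I M); rewrite row_mk iI.
Qed.

Lemma mrk_mk (M : 'M[F]_(5, 4)) I : mrk M I = \rank (mk I M).
Proof. by rewrite mrkE mk_sp. Qed.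

(* The minors that do not vanish at one point of a curve do not vanish nearby. *)
Lemma semicont (c : F -> 'M[F]_(5, 4)) t0 : pmx c ->
  exists2 q : {poly F}, q != 0 & forall t, ~~ root q t -> forall I, (mrk (c t0) I <= mrk (c t) I)%N.
Proof.
move=> pc.
have H I : exists q : {poly F}, q.[t0] != 0 /\
    forall t, q.[t] != 0 -> (mrk (c t0) I <= mrk (c t) I)%N.
  have [X [Y E]] := rank_witness (mk I (c t0)).
  have [q qE] : polyf (fun t => \det (X *m mk I (c t) *m Y)).
    apply: polyf_det; apply: pmx_mul; last exact: pmx_cst.
    by apply: pmx_mul; [exact: pmx_cst | exact: pmx_mk].
  exists q; rewrite -qE E det1 oner_eq0; split=> // t; rewrite -qE => dn.
  rewrite !mrk_mk.
  have : X *m mk I (c t) *m Y \in unitmx by rewrite unitmxE unitfE.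
  rewrite -row_free_unit => /eqP <-.
  by apply: leq_trans (mxrankM_maxl _ _) (mxrankM_maxr _ _).
have [q qP] := fin_all_exists H.
exists (\prod_I q I).
  apply/prodf_neq0 => I _; apply: contraNneq (qP I).1 => ->; by rewrite horner0.
move=> t nr I; apply: (qP I).2; apply: contraNneq nr => E0.
by rewrite /root horner_prod (bigD1 I) //= E0 mul0r.
Qed.

End PolyFun.

(** * Degenerations of orbits *)

Section Limits.
Variable F : fieldType.
Implicit Types M N : 'M[F]_(5, 4).

(* The torus of row scalings and [GL_4] act together by [M |-> diag s *m M *m g]. *)
Definition orbm M N : Prop := exists (s : 'rV[F]_5) (g : 'M[F]_4),
  [/\ forall i, s 0 i != 0, g \in unitmx & N = diag_mx s *m M *m g].

Lemma row_act (s : 'rV[F]_5) M (g : 'M_4) i :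
  row i (diag_mx s *m M *m g) = s 0 i *: (row i M *m g).
Proof. by rewrite !row_mul row_diag_mx -!scalemxAl -rowE. Qed.

Lemma orbm_rowP M N : (exists (s : 'I_5 -> F) g,
   [/\ forall i, s i != 0, (g : 'M[F]_4) \in unitmx & forall i, row i N = s i *: (row i M *m g)]) -> orbm M N.
Proof.
case=> s [g [s0 ug E]]; exists (\row_i s i), g; split=> // [i|]; first by rewrite mxE.
by apply/row_matrixP => i; rewrite row_act E mxE.
Qed.

Lemma orbm_refl M : orbm M M.
Proof.
exists (const_mx 1), 1%:M; rewrite unitmx1 diag_const_mx mul1mx mulmx1; split=> // i.
by rewrite mxE oner_eq0.
Qed.

Lemma diag_mx_mul (s t : 'rV[F]_5) : diag_mx s *m diag_mx t = diag_mx (\row_i (s 0 i * t 0 i)).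
Proof. by rewrite mulmx_diag; congr diag_mx; apply/rowP => i; rewrite !mxE. Qed.

Lemma orbm_trans M N P : orbm M N -> orbm N P -> orbm M P.
Proof.
move=> [s [g [s0 ug ->]]] [t [h [t0 uh ->]]]; exists (\row_i (t 0 i * s 0 i)), (g *m h).
rewrite unitmx_mul ug uh -diag_mx_mul !mulmxA; split=> // i.
by rewrite mxE mulf_neq0.
Qed.

Lemma orbm_sym M N : orbm M N -> orbm N M.
Proof.
move=> [s [g [s0 ug ->]]]; exists (\row_i (s 0 i)^-1), (invmx g).
rewrite unitmx_inv ug !mulmxA diag_mx_mul mulmxK //; split=> // [i|].
  by rewrite mxE invr_neq0.
rewrite (_ : \row_i _ = const_mx 1) ?diag_const_mx ?mul1mx //.
by apply/rowP => i; rewrite !mxE mulVf.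
Qed.

Lemma spM_sub M (I : {set 'I_5}) (g : 'M_4) m (W : 'M_(m, 4)) :
  (forall i, i \in I -> (row i M *m g <= W)%MS) -> (sp M I *m g <= W)%MS.
Proof.
move=> h; have le : (sp M I <= mk I M)%MS by rewrite mk_sp.
apply: submx_trans (submxMr g le) _.
apply/row_subP => i; rewrite row_mul row_mk; case: (boolP (i \in I)) => iI.
  by rewrite scale1r h.
by rewrite scale0r mul0mx sub0mx.
Qed.

Lemma orbm_mrk M N : orbm M N -> mrk N = mrk M.
Proof.
move=> [s [g [s0 ug ->]]]; apply/ffunP => I; rewrite !mrkE.
rewrite -(mxrankMfree (sp M I) (B := g)) ?row_free_unit //; apply/eqP; rewrite eqn_leq.
apply/andP; split; apply: mxrankS.
  apply/sp_subP => i iI; rewrite row_act scalemx_sub // submxMr //; exact: row_sp.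
apply: spM_sub => i iI.
by rewrite -(eqmx_scale _ (s0 i)) -row_act row_sp.
Qed.

(* Iterated limits of polynomial curves; together they are dense enough to replace the
   Zariski closure when exhibiting points of it. *)
Inductive lim (A : 'M[F]_(5, 4) -> Prop) : 'M[F]_(5, 4) -> Prop :=
| lim_in M : A M -> lim A M
| lim_curve c q : pmx c -> q != 0 -> (forall t, ~~ root q t -> lim A (c t)) -> lim A (c 0).

Lemma lim_act (A B : 'M[F]_(5, 4) -> Prop) (X : 'M_5) (Y : 'M_4) M :
  (forall M, A M -> B (X *m M *m Y)) -> lim A M -> lim B (X *m M *m Y).
Proof.
move=> h; elim=> {M} [M AM|c q pc q0 _ IH]; first by apply: lim_in; apply: h.
apply: (@lim_curve _ (fun t => X *m c t *m Y) q) => //.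
by apply: pmx_mul; [apply: pmx_mul => //|]; apply: pmx_cst.
Qed.

Lemma lim_lim (A B : 'M[F]_(5, 4) -> Prop) M : (forall N, A N -> lim B N) -> lim A M -> lim B M.
Proof.
by move=> h; elim=> {M} [M /h //|c q pc q0 _ IH]; apply: lim_curve IH.
Qed.

Lemma lim_sub (A B : 'M[F]_(5, 4) -> Prop) M : (forall N, A N -> B N) -> lim A M -> lim B M.
Proof. by move=> h; apply: lim_lim => N /h; apply: lim_in. Qed.

Lemma lim_orbm M N P : lim (orbm M) N -> orbm N P -> lim (orbm M) P.
Proof.
move=> h [s [g [s0 ug ->]]]; apply: lim_act h => Q MQ.
by apply: orbm_trans MQ _; exists s, g.
Qed.

Lemma lim_orbm_trans M N P : lim (orbm M) N -> lim (orbm N) P -> lim (orbm M) P.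
Proof. by move=> h; apply: lim_lim => Q; apply: lim_orbm. Qed.

(** The line joining [g] to the identity meets the singular matrices only at the roots of a nonzero
    polynomial, so singular [g] are reached in the limit. *)
Lemma lim_linear M (g : 'M_4) : lim (orbm M) (M *m g).
Proof.
have [q qE] : polyf (fun t => \det (itp g 1%:M t)) by apply: polyf_det; apply: pmx_itp.
rewrite -[g](itp0 g 1%:M); apply: (@lim_curve _ (fun t => M *m itp g 1%:M t) q).
- by apply: pmx_mul; [apply: pmx_cst | apply: pmx_itp].
- by apply: contra_eq_neq (qE 1) => ->; rewrite itp1 det1 horner0 oner_eq0.
move=> t; rewrite /root -qE => ug; apply: lim_in.
exists (const_mx 1), (itp g 1%:M t); rewrite unitmxE unitfE ug diag_const_mx mul1mx.
by split=> // i; rewrite mxE oner_eq0.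
Qed.

(** By semicontinuity at 1 the ranks are at least [phi] for almost all parameters, and the upper
    bound makes them equal. *)
Lemma lim_fiber (phi : setfun 'I_5) (c : F -> 'M_(5, 4)) : pmx c ->
  (forall t I, mrk (c t) I <= phi I)%N -> mrk (c 1) = phi ->
  lim (fun N => mrk N = phi) (c 0).
Proof.
move=> pc le E; have [q q0 h] := semicont 1 pc.
apply: (lim_curve pc q0) => t nr; apply: lim_in; apply/ffunP => I; apply/eqP.
by rewrite eqn_leq le -E h.
Qed.

(* Scaling to infinity along the span of [J] separates the points of [J] from the
   projections of the other points away from them. *)
Lemma lim_face M J : ranklike (mrk M) -> exists N, lim (orbm M) N /\ mrk N = face (mrk M) J.
Proof.
move=> rM; pose U := sp M J; pose E := proj_mx U (U^C)%MS.
have UU : (U :&: U^C)%MS = 0 by apply: capmx_compl.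
have EE : E *m E = E by apply: proj_mx_proj.
have EJ i : i \in J -> row i M *m E = row i M by move=> iJ; apply: proj_mx_id => //; apply: row_sp.
(* For nonzero [t] this is the image of [M] under the map that scales the span of [J] by [t] and
   fixes the chosen complement, the rows in [J] being scaled back by [t^-1]. *)
pose c t := \matrix_i (if i \in J then row i M else t *: (row i M *m E) + row i M *m (1%:M - E)).
have rc t i : row i (c t) = if i \in J then row i M else t *: (row i M *m E) + row i M *m (1%:M - E).
  exact: rowK.
exists (c 0); split.
  apply: (@lim_curve _ c 'X).
  - move=> i j; apply: (@polyf_ext _ (fun t => if i \in J then M i j else
       t * (row i M *m E) 0 j + (row i M *m (1%:M - E)) 0 j)).
      by move=> t; rewrite /c !mxE; case: ifP => _; rewrite !mxE.
    case: (i \in J); first exact: polyf_cst.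
    by apply: polyf_add; [apply: polyf_mul; [exact: polyf_id|]|]; exact: polyf_cst.
  - by rewrite polyX_eq0.
  move=> t; rewrite /root hornerX => t0; apply: lim_in; apply: orbm_rowP.
  exists (fun i => if i \in J then t^-1 else 1), (t *: E + (1%:M - E)); split.
  - by move=> i; case: ifP; rewrite ?invr_eq0 ?oner_eq0.
  - suff /mulmx1_unit[] : (t *: E + (1%:M - E)) *m (t^-1 *: E + (1%:M - E)) = 1%:M by [].
    have EF : E *m (1%:M - E) = 0 by rewrite mulmxBr mulmx1 EE subrr.
    have FE : (1%:M - E) *m E = 0 by rewrite mulmxBl mul1mx EE subrr.
    have FF : (1%:M - E) *m (1%:M - E) = 1%:M - E by rewrite {1}mulmxBl mul1mx EF subr0.
    have: E + (1%:M - E) = 1%:M by rewrite addrC subrK.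
    move: (1%:M - E) EF FE FF => G EF FE FF.
    rewrite mulmxDl !mulmxDr -!scalemxAl -!scalemxAr EE EF FE FF.
    by rewrite scalerA divff // scale1r !scaler0 addr0 add0r.
  - move=> i; rewrite rc [row i M *m (_ *: _ + _)]mulmxDr -scalemxAr; case: ifP => [iJ|_]; last by rewrite scale1r.
    by rewrite mulmxBr mulmx1 EJ // subrr addr0 scalerA mulVf // scale1r.
apply/ffunP => I; rewrite [RHS]ffunE !mrkE.
(* At 0 the span splits into a part inside [U] and a part inside its complement, so that ranks add;
   [EU] gives the same splitting for [I :|: J]. *)
have c0E : (sp (c 0) I :=: sp M (I :&: J) + sp M (I :\: J) *m (1%:M - E))%MS.
  apply/eqmxP/andP; split.
    apply/sp_subP => i iI; rewrite rc; case: ifP => iJ.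
      by apply: submx_trans (addsmxSl _ _); apply: row_sp; rewrite inE iI iJ.
    rewrite scale0r add0r; apply: submx_trans (addsmxSr _ _); apply: submxMr.
    by apply: row_sp; rewrite !inE iI iJ.
  rewrite addsmx_sub; apply/andP; split.
    apply/sp_subP => i; rewrite inE => /andP[iI iJ].
    by have := row_sp (c 0) iI; rewrite rc iJ.
  apply: spM_sub => i; rewrite !inE => /andP[/negbTE iJ iI].
  by have := row_sp (c 0) iI; rewrite rc iJ scale0r add0r.
have BC : (sp M (I :\: J) *m (1%:M - E) <= U^C)%MS.
  by rewrite mulmxBr mulmx1; apply: proj_mx_compl_sub; rewrite submx_full ?addsmx_compl_full.
have AU : (sp M (I :&: J) <= U)%MS by apply: spS; apply: subsetIr.
have rk0 m (A : 'M_(m, 4)) : (A <= U)%MS ->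
    \rank (A + sp M (I :\: J) *m (1%:M - E))%MS = (\rank A + \rank (sp M (I :\: J) *m (1%:M - E)))%N.
  move=> AU'; have := mxrank_sum_cap A (sp M (I :\: J) *m (1%:M - E)).
  suff -> : (A :&: sp M (I :\: J) *m (1%:M - E))%MS = 0 by rewrite mxrank0 addn0.
  apply/eqP; rewrite -submx0 -UU sub_capmx (submx_trans (capmxSl _ _) AU').
  exact: submx_trans (capmxSr _ _) BC.
have EU : (sp M (I :|: J) :=: U + sp M (I :\: J) *m (1%:M - E))%MS.
  apply/eqmxP/andP; split.
    apply/sp_subP => i; rewrite inE; case: (boolP (i \in J)) => iJ.
      by move=> _; apply: submx_trans (addsmxSl _ _); apply: row_sp.
    rewrite orbF => iI.
    have -> : row i M = row i M *m E + row i M *m (1%:M - E).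
      by rewrite -mulmxDr [E + _]addrC subrK mulmx1.
    rewrite addmx_sub_adds //.
      exact: proj_mx_sub.
    by apply: submxMr; apply: row_sp; rewrite !inE iJ iI.
  rewrite addsmx_sub spS ?subsetUr //=; apply: spM_sub => i; rewrite !inE => /andP[iJ iI].
  rewrite mulmxBr mulmx1 addmx_sub //; first by apply: row_sp; rewrite inE iI.
  rewrite eqmx_opp; apply: submx_trans (proj_mx_sub _ _ _) _; apply: spS; exact: subsetUr.
rewrite c0E EU !rk0 ?submx_refl //.
by rewrite -/U addnC -addnA addKn.
Qed.

End Limits.

(** * The closure of a whole stratum *)

Section Density.
Variable F : fieldType.
Implicit Types M N : 'M[F]_(5, 4).

Lemma parallel_row M i j : row j M != 0 -> (mrk M [set i; j] <= 1)%N ->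
  exists a, row i M = a *: row j M.
Proof.
move=> nz h; apply/sub_rVP.
suff : (row i M <= sp M [set j])%MS by rewrite sp1.
rewrite -mrk_mem eqn_leq; apply/andP; split; last by rewrite mrk_mono ?subsetUr.
by apply: leq_trans h _; rewrite mrkE sp1 rank_rV nz.
Qed.

(** Rows are multiples of the representative rows, all of which factor through dimension [phi setT],
    and those in [S] through dimension [phi S]. Both [M] and [N] have such factors, and arbitrary
    factors give ranks at most [phi], so the interpolated factors form an admissible curve. *)
Lemma lim_flag (phi : setfun 'I_5) S r M N :
  flag_form phi S r -> (forall i, row i M != 0) -> (forall I, mrk M I <= phi I)%N ->
  (forall i, row i N != 0) -> mrk N = phi -> lim (fun P => mrk P = phi) M.
Proof.
case=> par rS bound M0 Mle N0 NE.
pose s2 := phi setT; pose s1 := phi S.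
pose c (d : 'rV[F]_5) (A' : 'M[F]_(5, s1)) (P' : 'M_(s1, s2)) (A : 'M_(5, s2)) (P : 'M_(s2, 4)) :=
  diag_mx d *m rowsub r ((mk S (A' *m P') + mk (~: S) A) *m P).
have ex X : (forall i, row i X != 0) -> (forall I, mrk X I <= phi I)%N ->
    exists d A' P' A P, X = c d A' P' A P.
  move=> X0 Xle.
  have [A0 [P XE]] : exists (A : 'M_(5, s2)) (P : 'M_(s2, 4)), X = A *m P.
    apply: rank_factor; apply: leq_trans (Xle setT); rewrite mrk_mk.
    apply: mxrankS; apply/row_subP => i.
    by have := row_sub i (mk setT X); rewrite row_mk in_setT scale1r.
  (* With this choice the rows of [A] in [S] are images of the rows of [X] in [S], hence have rank
     at most [phi S]. *)
  pose A := X *m pinvmx P.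
  have XA : X = A *m P by rewrite mulmxKpV // XE submxMl.
  have [A' [P' SE]] : exists (A' : 'M_(5, s1)) (P' : 'M_(s1, s2)), mk S A = A' *m P'.
    apply: rank_factor; apply: leq_trans (Xle S); rewrite mrk_mk /A /mk mulmxA.
    exact: mxrankM_maxl.
  have [d dE] : exists d : 'I_5 -> F, forall i, row i X = d i *: row (r i) X.
    apply: (@fin_all_exists _ (fun=> F) (fun i a => row i X = a *: row (r i) X)) => i.
    apply: parallel_row => //; exact: leq_trans (Xle _) (par i).
  exists (\row_i d i), A', P', A, P; rewrite /c -SE.
  have -> : mk S (mk S A) + mk (~: S) A = A.
    apply/row_matrixP => i; rewrite linearD /= !row_mk inE.
    by case: (i \in S); rewrite !(scale1r, scale0r, addr0, add0r).
  rewrite -XA; apply/row_matrixP => i.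
  by rewrite row_mul row_diag_mx -scalemxAl -rowE mxE row_rowsub.
have [d0 [A0' [P0' [A0 [P0 ME]]]]] := ex M M0 Mle.
have Nle I : (mrk N I <= phi I)%N by rewrite NE.
have [d1 [A1' [P1' [A1 [P1 NE']]]]] := ex N N0 Nle.
pose ct t := c (itp d0 d1 t) (itp A0' A1' t) (itp P0' P1' t) (itp A0 A1 t) (itp P0 P1 t).
have -> : M = ct 0 by rewrite /ct !itp0.
apply: lim_fiber; last by rewrite /ct !itp1 -NE'.
  apply: pmx_mul.
    move=> i j; apply: (@polyf_ext _ (fun t => itp d0 d1 t 0 i *+ (i == j))).
      by move=> t; rewrite !mxE.
    case: (i == j); first exact: (pmx_itp d0 d1 0 i).
    exact: polyf_cst.
  move=> i j; apply: (@polyf_ext _ (fun t => ((mk S (itp A0' A1' t *m itp P0' P1' t) +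
    mk (~: S) (itp A0 A1 t)) *m itp P0 P1 t) (r i) j)); first by move=> t; rewrite [RHS]mxE.
  apply: pmx_mul; last exact: pmx_itp.
  apply: pmx_add; apply: pmx_mk; last exact: pmx_itp.
  by apply: pmx_mul; apply: pmx_itp.
move=> t I; rewrite /ct; move: (itp d0 d1 t) (itp A0' A1' t) (itp P0' P1' t) (itp A0 A1 t) (itp P0 P1 t).
move=> d A' P' A P; apply: leq_trans (bound I).
set Q := (mk S (A' *m P') + mk (~: S) A) *m P.
have : (mrk (c d A' P' A P) I <= mrk Q (r @: I))%N.
  apply: mrk_le_sub; apply/sp_subP => i iI.
  rewrite /c row_mul row_diag_mx -scalemxAl -rowE scalemx_sub // row_rowsub.
  by apply: row_sp; apply: imset_f.
move/leq_trans; apply; rewrite leq_min; apply/andP; split.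
  rewrite mrk_mk /mk /Q mulmxA; exact: leq_trans (mxrankM_maxr _ _) (rank_leq_row _).
have -> : r @: I = (r @: (I :&: S)) :|: (r @: (I :\: S)) by rewrite -imsetU setID.
apply: leq_trans (leq_trans (leq_addr _ _) (mrkU Q _ _)) _.
apply: leq_add; last exact: mrk_card.
rewrite leq_min mrk_card andbT.
have : (sp Q (r @: (I :&: S)%SET) <= P' *m P)%MS.
  apply/sp_subP => _ /imsetP[i /setIP[_ iS] ->].
  rewrite /Q row_mul linearD /= !row_mk inE rS iS scale1r scale0r addr0.
  by rewrite row_mul -mulmxA submxMl.
by rewrite mrkE => /mxrankS/leq_trans; apply; apply: rank_leq_row.
Qed.

Lemma rV_complement m (v : 'rV[F]_4) (W : 'M_(m, 4)) : v != 0 -> (v <= W)%MS -> (\rank W <= 2)%N ->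
  exists x : 'rV[F]_4, (W <= v + x)%MS.
Proof.
move=> v0 vW rW.
have : (\rank (W :\: v)%MS <= 1)%N.
  rewrite -(leq_add2l (\rank (W :&: v)%MS)) mxrank_cap_compl (leq_trans rW) //.
  have vc : (v <= W :&: v)%MS by rewrite sub_capmx vW submx_refl.
  by rewrite addn1 ltnS; have := mxrankS vc; rewrite rank_rV v0.
move=> /rank_factor[A [x E]]; exists x.
rewrite -(addsmx_diff_cap_eq W v) addsmx_sub E; apply/andP; split.
  exact: submx_trans (submxMl _ _) (addsmxSr _ _).
exact: submx_trans (capmxSr _ _) (addsmxSl _ _).
Qed.

Lemma uniq_all_ords (s : seq 'I_5) : uniq s -> size s = 5 -> forall i, i \in s.
Proof.
move=> us ss i; have := @uniq_min_size _ s (enum 'I_5) us.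
rewrite size_enum_ord ss leqnn => h; have [|_ E] := h _ isT; first by move=> x; rewrite mem_enum.
by rewrite E mem_enum.
Qed.

(** The rows on one line are combinations of [v] and [x], those on the other of [v] and [y], where
    [v] represents the common point. The conditions [good] on the coefficients are linear, so
    interpolation preserves them. *)
Lemma lim_cross (phi : setfun 'I_5) a b c d e M N :
  cross_form phi a b c d e -> (forall i, row i M != 0) -> (forall I, mrk M I <= phi I)%N ->
  (forall i, row i N != 0) -> mrk N = phi -> lim (fun P => mrk P = phi) M.
Proof.
case=> up abc ade bound M0 Mle N0 NE.
have all5 := uniq_all_ords up erefl.
pose A := [set a; b; c]; pose B := [set a; d; e].
have AB i : (i \in A) || (i \in B).
  by have := all5 i; rewrite !inE; do 5 case: (i == _).
pose cv (al be ga : 'rV[F]_5) (v x y : 'rV[F]_4) : 'M[F]_(5, 4) :=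
  \matrix_i (al 0 i *: v + be 0 i *: x + ga 0 i *: y).
pose good (al be ga : 'rV[F]_5) := [/\ be 0 a = 0, ga 0 a = 0,
   forall i, i \in A -> ga 0 i = 0 & forall i, i \in B -> be 0 i = 0].
have ex X : (forall i, row i X != 0) -> (forall I, mrk X I <= phi I)%N ->
    exists al be ga v x y, X = cv al be ga v x y /\ good al be ga.
  move=> X0 Xle.
  have [||x xE] := @rV_complement _ (row a X) (sp X A) (X0 a).
  - by apply: row_sp; rewrite !inE eqxx.
  - by rewrite -mrkE; apply: leq_trans (Xle A) abc.
  have [||y yE] := @rV_complement _ (row a X) (sp X B) (X0 a).
  - by apply: row_sp; rewrite !inE eqxx.
  - by rewrite -mrkE; apply: leq_trans (Xle B) ade.
  have : forall i, exists k : F * F * F, [/\ row i X = k.1.1 *: row a X + k.1.2 *: x + k.2 *: y,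
      i == a -> k.1.2 = 0 /\ k.2 = 0, i \in A -> k.2 = 0 & i \in B -> k.1.2 = 0].
    move=> i; have [->|ia] := eqVneq i a.
      by exists (1, 0, 0); rewrite /= scale1r !scale0r !addr0.
    have [iA|iA] := boolP (i \in A).
      have := submx_trans (row_sp X iA) xE => /sub_addsmxP[[u w] /= E].
      exists (u 0 0, w 0 0, 0) => /=; split=> //.
        by rewrite scale0r addr0 -!mul_scalar_mx -!mx11_scalar E.
      (* The sets [A] and [B] have only [a] in common. *)
      move=> iB; have nd : uniq [:: a; b; c; d; e] := up.
      exfalso; move: iA iB ia up; rewrite !inE => /orP[/orP[]|] /eqP ->;
        rewrite ?eqxx // => + _ /=; rewrite !inE !negb_or;
        by move=> /orP[/orP[]|] /eqP ->; rewrite ?eqxx ?andbF.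
    have iB : i \in B by have := AB i; rewrite (negbTE iA).
    have := submx_trans (row_sp X iB) yE => /sub_addsmxP[[u w] /= E].
    exists (u 0 0, 0, w 0 0) => /=; split=> //.
    by rewrite scale0r addr0 -!mul_scalar_mx -!mx11_scalar E.
  case/(@fin_all_exists _ (fun=> (F * F * F)%type)) => k kP.
  exists (\row_i (k i).1.1), (\row_i (k i).1.2), (\row_i (k i).2), (row a X), x, y; split.
    by apply/row_matrixP => i; rewrite rowK !mxE; case: (kP i).
  have [_ /(_ (eqxx a))[k1 k2] _ _] := kP a.
  by split=> [||i|i]; rewrite !mxE //; case: (kP i).
have [al0 [be0 [ga0 [v0 [x0 [y0 [ME [g01 g02 g03 g04]]]]]]]] := ex M M0 Mle.
have Nle I : (mrk N I <= phi I)%N by rewrite NE.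
have [al1 [be1 [ga1 [v1 [x1 [y1 [NE' [g11 g12 g13 g14]]]]]]]] := ex N N0 Nle.
pose ct t := cv (itp al0 al1 t) (itp be0 be1 t) (itp ga0 ga1 t) (itp v0 v1 t) (itp x0 x1 t) (itp y0 y1 t).
have -> : M = ct 0 by rewrite /ct !itp0.
apply: lim_fiber; last by rewrite /ct !itp1 -NE'.
  move=> i j; apply: (@polyf_ext _ (fun t => itp al0 al1 t 0 i * itp v0 v1 t 0 j +
     itp be0 be1 t 0 i * itp x0 x1 t 0 j + itp ga0 ga1 t 0 i * itp y0 y1 t 0 j)).
    by move=> t; rewrite !mxE.
  apply: polyf_add; last by apply: polyf_mul; apply: pmx_itp.
  by apply: polyf_add; apply: polyf_mul; apply: pmx_itp.
move=> t I; rewrite /ct.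
have : good (itp al0 al1 t) (itp be0 be1 t) (itp ga0 ga1 t).
  split=> [||i iA|i iB]; rewrite /itp !mxE ?g01 ?g02 ?g11 ?g12 ?(g03 _ iA) ?(g13 _ iA) ?(g04 _ iB) ?(g14 _ iB);
    by rewrite subrr mulr0 addr0.
move: (itp al0 al1 t) (itp be0 be1 t) (itp ga0 ga1 t) (itp v0 v1 t) (itp x0 x1 t) (itp y0 y1 t).
move=> al be ga v x y [_ _ gA gB]; apply: leq_trans (bound I).
rewrite leq_min mrk_card andbT.
have rs (s : nat) (P : 'M_(s, 4)) : (forall i, i \in I -> (row i (cv al be ga v x y) <= P)%MS) ->
    (mrk (cv al be ga v x y) I <= s)%N.
  by move=> h; rewrite mrkE; apply: leq_trans (rank_leq_row P); apply: mxrankS; apply/sp_subP.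
case: ifP => [/orP[]/subsetP IS|_].
- apply: (rs (1 + 1)%N (col_mx v x)) => i /IS iA; rewrite rowK gA // scale0r addr0.
  by rewrite -addsmxE addmx_sub_adds // scalemx_sub.
- apply: (rs (1 + 1)%N (col_mx v y)) => i /IS iB; rewrite rowK gB // scale0r addr0.
  by rewrite -addsmxE addmx_sub_adds // scalemx_sub.
apply: (rs (1 + 1 + 1)%N (col_mx (col_mx v x) y)) => i _; rewrite rowK.
rewrite -addsmxE addmx_sub_adds ?scalemx_sub // -addsmxE.
by rewrite addmx_sub_adds // scalemx_sub.
Qed.

Lemma lim_below (phi : setfun 'I_5) M N : (forall i, row i M != 0) -> (forall I, mrk M I <= phi I)%N ->
  (forall i, row i N != 0) -> mrk N = phi -> lim (fun P => mrk P = phi) M.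
Proof.
move=> M0 le N0 NE; have : ranklike phi by rewrite -NE; apply: mrk_ranklike.
case/param => [[S [r ff]]|[a [b [c [d [e cf]]]]]]; first exact: lim_flag ff M0 le N0 NE.
exact: lim_cross cf M0 le N0 NE.
Qed.

End Density.

(** * Strata consisting of a single orbit *)

Section Tame.
Variable F : fieldType.
Implicit Types M N : 'M[F]_(5, 4).

(** The scalars are found along the elimination order: each new vertex has at most one neighbour
    among those already treated, hence satisfies at most one equation, with nonzero coefficients. *)
Lemma forest_scaling (phi : setfun 'I_5) b p (A B : 'I_5 -> 'I_5 -> F) :
  uniq p -> forest phi b p ->
  (forall i j, exch phi b i j -> A i j != 0 /\ B i j != 0) ->
  exists s : 'I_5 -> F, (forall i, s i != 0) /\
    forall i j, i \in p -> j \in p -> exch phi b i j -> s i * A i j = B i j * s j.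
Proof.
move=> + + AB; elim: p => [_ _|v p IH /= /andP[vp up] /andP[cnt fp]].
  by exists (fun=> 1); split=> // i; apply: oner_neq0.
have [s [s0 sE]] := IH up fp.
have exN i j : exch phi b i j -> exch phi b j i = false.
  by case/and3P => /negbTE ib jb _; rewrite /exch jb.
have ne i : i \in p -> i == v = false by move=> ip; apply: contraNF vp => /eqP <-.
have uq i j : i \in p -> j \in p -> adj phi b v i -> adj phi b v j -> i = j.
  move=> ip jp vi vj; move: cnt; rewrite -size_filter.
  have : i \in [seq x <- p | adj phi b v x] by rewrite mem_filter vi.
  have : j \in [seq x <- p | adj phi b v x] by rewrite mem_filter vj.
  by case: [seq x <- p | _] => [|x [|]] //; rewrite !inE => /eqP -> /eqP ->.
(* The two formulas solve the same equation, according to which end of the edge lies outside [b]. A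
   vertex without neighbours receives 1. *)
pose sv := if [pick u in p | adj phi b v u] is Some u then
   (if exch phi b v u then B v u * s u / A v u else s u * A u v / B u v) else 1.
have svE u : u \in p -> adj phi b v u ->
    sv = if exch phi b v u then B v u * s u / A v u else s u * A u v / B u v.
  move=> up' vu; rewrite /sv; case: pickP => [x /andP[xp vx]|/(_ u)]; last by rewrite up' vu.
  by rewrite (uq x u).
have sv0 : sv != 0.
  rewrite /sv; case: pickP => [u /andP[_ /orP[] h]|_]; last exact: oner_neq0.
    by rewrite h; have [a0 b0] := AB _ _ h; rewrite !mulf_neq0 ?invr_neq0.
  by rewrite (exN _ _ h); have [a0 b0] := AB _ _ h; rewrite !mulf_neq0 ?invr_neq0.
exists (fun i => if i == v then sv else s i); split=> [i|i j]; first by case: ifP.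
rewrite !inE; case: (eqVneq i v) => [->|_] /=; case: (eqVneq j v) => [->|_] //=.
- by move=> _ _ h; move: (exN _ _ h); rewrite h.
- move=> _ jp h; rewrite (svE j) //; last by rewrite /adj h.
  rewrite h.
  by have [a0 _] := AB _ _ h; rewrite divfK.
- move=> ip _ h; rewrite (svE i) //; last by rewrite /adj h orbT.
  rewrite (exN _ _ h).
  by have [_ b0] := AB _ _ h; rewrite mulrCA divff // mulr1.
exact: sE.
Qed.

(** The basis survives the exchange of [j] for [i] exactly when row [j] can be solved for in the
    expansion of row [i], that is, when its coefficient is nonzero. *)
Lemma basis_coefs M (b : {set 'I_5}) : #|b| = mrk M b -> mrk M b = mrk M setT ->
  exists A : 'M[F]_5, (forall i, row i M = \sum_(j in b) A i j *: row j M) /\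
    forall i j, i \notin b -> j \in b -> (A i j != 0) = exch (mrk M) b i j.
Proof.
move=> cb bT.
have spb i : (row i M <= mk b M)%MS.
  rewrite mk_sp -mrk_mem eqn_leq; apply/andP; split; last by rewrite mrk_mono ?subsetUr.
  by rewrite bT mrk_mono ?subsetT.
have ex i : exists u : 'rV[F]_5, row i M = \sum_(j in b) u 0 j *: row j M.
  have /submxP[u ->] := spb i; exists u; rewrite mulmx_sum_row [RHS]big_mkcond.
  by apply: eq_bigr => j _; rewrite row_mk; case: (j \in b); rewrite ?scale1r // scale0r scaler0.
have [A AE] := fin_all_exists ex.
exists (\matrix_i A i); split=> [i|i j ib jb].
  by rewrite {1}AE; apply: eq_bigr => j _; rewrite !mxE.
have {AE} AE : row i M = (A i) 0 j *: row j M + \sum_(k in b :\ j) (A i) 0 k *: row k M.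
  rewrite {1}AE (bigD1 j) //=; congr (_ + _); apply: eq_bigl => k; by rewrite !inE andbC.
rewrite mxE /exch ib jb /=; have [A0|A0] := eqVneq (A i 0 j) 0.
  apply/esym/negbTE; rewrite neq_ltn; apply/orP; left.
  have /eqP -> : mrk M (i |: b :\ j) == mrk M (b :\ j).
    rewrite mrk_mem AE A0 scale0r add0r; apply: summx_sub => k kb.
    by rewrite scalemx_sub // row_sp.
  rewrite -cb; apply: leq_ltn_trans (mrk_card _ _) _; by rewrite (cardsD1 j b) jb.
apply/esym; rewrite eqn_leq {1}bT mrk_mono ?subsetT //=; apply: mrk_le_sub.
apply/sp_subP => k kb; have [->|kj] := eqVneq k j; last first.
  by apply: row_sp; rewrite !inE kj kb orbT.
have -> : row j M = (A i 0 j)^-1 *: (row i M - \sum_(k in b :\ j) (A i) 0 k *: row k M).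
  by rewrite AE addrK scalerA mulVf // scale1r.
rewrite scalemx_sub // addmx_sub //; first by apply: row_sp; rewrite !inE eqxx.
rewrite eqmx_opp; apply: summx_sub => l lb; apply: scalemx_sub; apply: row_sp.
by rewrite inE lb orbT.
Qed.

(** The scalars [s] match the coefficients of both matrices with respect to the common basis [b].
    The linear map sending each basis row of [M] to the suitably scaled row of [N] then carries all
    rows. *)
Lemma tame_orbm M N : tame (mrk M) -> mrk N = mrk M -> orbm M N.
Proof.
case/tameP => b [p [cb bT up allp fp]] NM.
have [A [AE A0]] := basis_coefs cb bT.
have [|| B [BE B0]] := @basis_coefs N b; [by rewrite NM | by rewrite NM |].
have [|s [s0 sE]] := @forest_scaling _ b p A B up fp.
  by move=> i j h; have /and3P[ib jb _] := h; rewrite A0 // B0 // NM.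
have sAB i j : i \notin b -> j \in b -> s i * A i j = B i j * s j.
  move=> ib jb; case: (boolP (exch (mrk M) b i j)) => h; first exact: sE.
  move: (h); rewrite -A0 // negbK => /eqP ->; move: h; rewrite -NM -B0 // negbK => /eqP ->.
  by rewrite mulr0 mul0r.
pose e := @enum_val _ (mem b).
pose X := rowsub e M; pose Y := rowsub e (diag_mx (\row_i (s i)^-1) *m N).
have rowY k : row k Y = (s (e k))^-1 *: row (e k) N.
  by rewrite row_rowsub row_mul row_diag_mx -scalemxAl -rowE mxE.
have rk (L : 'M[F]_(5, 4)) : mrk L b = #|b| -> row_free (rowsub e L).
  move=> E; rewrite /row_free eqn_leq rank_leq_row /= -{1}E mrkE; apply: mxrankS.
  apply/sp_subP => i ib; have := row_sub (enum_rank_in ib i) (rowsub e L).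
  by rewrite row_rowsub /e enum_rankK_in.
have fX : row_free X by apply: rk; rewrite -cb.
have fY : row_free Y.
  apply: rk; rewrite (@orbm_mrk _ N); first by rewrite NM -cb.
  apply: orbm_rowP; exists (fun i => (s i)^-1), 1%:M; split=> // [i||i].
  - by rewrite invr_neq0.
  - exact: unitmx1.
  - by rewrite mulmx1 row_mul row_diag_mx -scalemxAl -rowE mxE.
(* The map between the spans of the basis rows preserves rank and therefore extends to an invertible
   map. *)
have [|g ug gE] := @complete_unitmx _ _ _ X (pinvmx X *m Y).
  by rewrite mulmxA mulmxVp // mul1mx (eqP fX) (eqP fY).
have gb j : j \in b -> row j M *m g = (s j)^-1 *: row j N.
  move=> jb; have := congr1 (row (enum_rank_in jb j)) gE.
  by rewrite mulmxA mulmxVp // mul1mx rowY row_mul row_rowsub /e enum_rankK_in // => ->.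
apply: orbm_rowP; exists s, g; split=> // i.
have [ib|ib] := boolP (i \in b); first by rewrite gb // scalerA divff // scale1r.
rewrite BE AE mulmx_suml scaler_sumr; apply: eq_bigr => j jb.
rewrite -scalemxAl gb // !scalerA sAB //.
by rewrite -mulrA divff // mulr1.
Qed.

End Tame.

(** * Limits of single orbits in wild strata *)

Section Wild.
Variable F : fieldType.
Hypothesis charF : [pchar F] =i pred0.
Implicit Types M N z : 'M[F]_(5, 4).

Lemma natr_inj_char0 : injective (fun n : nat => n%:R : F).
Proof.
move=> m n; wlog le : m n / (m <= n)%N.
  by move=> h E; case: (leqP m n) => [/h|/ltnW/h h']; [apply | apply/esym/h'/esym].
move=> /eqP; rewrite eq_sym -subr_eq0 -natrB // ((pcharf0P F).1 charF) subn_eq0 => nm.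
by apply/eqP; rewrite eqn_leq le.
Qed.

Lemma fresh_element (s : seq F) : exists t, t \notin s.
Proof.
pose r := [seq n%:R : F | n <- iota 0 (size s).+1].
have ur : uniq r by rewrite map_inj_uniq ?iota_uniq //; apply: natr_inj_char0.
have [/allP h|/allPn[t _ ts]] := boolP (all (mem s) r); last by exists t.
by have := uniq_leq_size ur h; rewrite size_map size_iota ltnn.
Qed.

Lemma pair_indep M i j (x y : F) : mrk M [set i; j] = 2 ->
  x *: row i M + y *: row j M = 0 -> x = 0 /\ y = 0.
Proof.
have key k l (x' y' : F) : mrk M [set k; l] = 2 -> x' *: row k M + y' *: row l M = 0 -> x' = 0.
  move=> E2 /eqP E; apply/eqP/negPn/negP => x0.
  have : (row k M <= sp M [set l])%MS.
    rewrite sp1; apply/sub_rVP; exists (- (y' / x')).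
    apply: (scalerI x0); rewrite scalerA mulrN mulrC divfK // scaleNr.
    by apply/eqP; rewrite -addr_eq0.
  rewrite -mrk_mem E2 => /eqP E1; have := mrk_card M [set l]; by rewrite -E1 cards1.
move=> E2 E; split; first exact: key E2 E.
by apply: (key j i y x); rewrite 1?setUC // addrC.
Qed.

(* A linear map sends the points of [z] into the lines spanned by the points of [N]:
   five linear conditions on a 3 x 2 matrix. *)
Lemma rank3_to_rank2 z N : simple_big (mrk z) -> (forall i, row i N != 0) ->
  (mrk N setT <= 2)%N -> (forall i j, i != j -> mrk N [set i; j] = 2) ->
  exists (g : 'M_4) (k : 'I_5 -> F), (forall i, row i z *m g = k i *: row i N) /\
    (forall i j, i != j -> k i = 0 -> k j != 0).
Proof.
case=> z3 z2 z4 N0 rN N2.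
have mkT (L : 'M[F]_(5, 4)) : mk setT L = L.
  by apply/row_matrixP => i; rewrite row_mk in_setT scale1r.
have rz : \rank z = 3 by rewrite -{1}(mkT z) -mrk_mk.
have [A [P zE]] : exists (A : 'M_(5, 3)) (P : 'M_(3, 4)), z = A *m P by apply: rank_factor; rewrite rz.
have [V [Q NE]] : exists (V : 'M_(5, 2)) (Q : 'M_(2, 4)), N = V *m Q.
  by apply: rank_factor; rewrite -(mkT N) -mrk_mk.
have fP : row_free P.
  by have := mxrankM_maxr A P; rewrite -zE rz /row_free eqn_leq rank_leq_row.
have fA : row_free A^T.
  by have := mxrankM_maxl A P; rewrite -zE rz /row_free eqn_leq rank_leq_row mxrank_tr.
(* Column [i] expresses that the image of point [i] is proportional to row [i] of [V]. Six unknowns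
   against five equations leave a nonzero solution [u]. *)
pose T : 'M_(3 + 3, 5) := col_mx (A^T *m diag_mx (\row_i V i 1)) (- (A^T *m diag_mx (\row_i V i 0))).
have [u u0 uT] : exists2 u : 'rV_(3 + 3), u != 0 & u *m T = 0.
  have : kermx T != 0 by rewrite kermx_eq0 /row_free neq_ltn ltnS rank_leq_col.
  case/rowV0Pn => u /sub_kermxP uT u0; by exists u.
pose x := lsubmx u; pose y := rsubmx u.
have uE : u = row_mx x y by rewrite hsubmxK.
pose al := x *m A^T; pose be := y *m A^T.
have prop i : al 0 i * V i 1 = be 0 i * V i 0.
  have := congr1 (fun X : 'rV_5 => X 0 i) uT; rewrite uE mul_row_col mulmxN !mulmxA.
  by rewrite !mul_mx_diag !mxE -/al -/be => /eqP; rewrite subr_eq0 => /eqP.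
have VN i : row i N = row i V *m Q by rewrite NE row_mul.
have [k kE] : exists k : 'I_5 -> F, forall i, al 0 i = k i * V i 0 /\ be 0 i = k i * V i 1.
  apply: (@fin_all_exists _ (fun=> F) (fun i k => al 0 i = k * V i 0 /\ be 0 i = k * V i 1)) => i.
  have [V0|V0] := eqVneq (V i 0) 0.
    have V1 : V i 1 != 0.
      apply: contraNneq (N0 i) => V1; rewrite VN (_ : row i V = 0) ?mul0mx //.
      apply/rowP => j; rewrite !mxE; case: j => [[|[|]]] //= lt.
        by rewrite -[RHS]V0; congr (V i _); apply: val_inj.
      by rewrite -[RHS]V1; congr (V i _); apply: val_inj.
    exists (be 0 i / V i 1); rewrite V0 mulr0 divfK //; split=> //.
    by apply: (mulIf V1); rewrite prop V0 mulr0 mul0r.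
  exists (al 0 i / V i 0); rewrite divfK //; split=> //.
  by apply: (mulIf V0); rewrite -prop mulrAC divfK.
pose g := (col_mx x y)^T.
have Ag i : row i (A *m g) = k i *: row i V.
  apply/rowP => j; rewrite !mxE.
  have -> : \sum_l A i l * g l j = (col_mx x y *m A^T) j i.
    by rewrite mxE; apply: eq_bigr => l _; rewrite !mxE mulrC.
  rewrite mul_col_mx -/al -/be; have [aE bE] := kE i; case: j => [[|[|]]] //= lt.
    rewrite (_ : Ordinal lt = lshift 1 0); last exact: val_inj.
    by rewrite col_mxEu aE; congr (_ * V i _); apply: val_inj.
  rewrite (_ : Ordinal lt = rshift 1 0); last exact: val_inj.
  by rewrite col_mxEd bE; congr (_ * V i _); apply: val_inj.
pose G := pinvmx P *m g *m Q.
have zG i : row i z *m G = k i *: row i N.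
  have -> : row i z *m G = row i (A *m g *m Q).
    by rewrite -row_mul zE /G -(mulmxA A P) -(mulmxA (pinvmx P)) (mulmxA P) mulmxVp // mul1mx mulmxA.
  by rewrite row_mul Ag -scalemxAl VN.
exists G, k; split=> // i j ij ki; apply/negP => /eqP kj.
(* Two independent rows in the kernel leave an image of rank at most 1, so at most one multiplier is
   nonzero. The other four points span, hence the kernel contains everything; then [u] vanishes, a
   contradiction. *)
have k_all : forall l, k l = 0.
  have ker l : k l = 0 -> (row l z <= kermx G)%MS.
    by move=> kl; apply/sub_kermxP; rewrite zG kl scale0r.
  have rk1 : (\rank (z *m G) <= 1)%N.
    have := mxrank_mul_ker z G; rewrite rz => E; rewrite -(leq_add2r 2) -[X in (_ <= X)%N]E leq_add2l.
    apply: leq_trans (_ : mrk z [set i; j] <= _)%N; first by rewrite z2.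
    rewrite mrkE; apply: mxrankS; rewrite sub_capmx; apply/andP; split.
      by apply/sp_subP => l _; apply: row_sub.
    by apply/sp_subP => l; rewrite !inE => /orP[]/eqP ->; apply: ker.
  have two a b : a != b -> k a != 0 -> k b = 0.
    move=> ab ka; apply/eqP/negPn/negP => kb.
    suff : (mrk N [set a; b] <= 1)%N by rewrite N2.
    apply: leq_trans rk1; rewrite mrkE; apply: mxrankS; apply/sp_subP => l.
    rewrite !inE => /orP[]/eqP ->; [rewrite -(eqmx_scale _ ka)|rewrite -(eqmx_scale _ kb)];
      by rewrite -zG -row_mul row_sub.
  have [l lE] : exists l, forall m, m != l -> k m = 0.
    have [l kl|none] := pickP (fun l => k l != 0); last by exists i => m _; have /negbFE/eqP := none m.
    by exists l => m ml; apply: (two l) => //; rewrite eq_sym.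
  have : (sp z setT <= kermx G)%MS.
    apply: submx_trans (_ : sp z (~: [set l]) <= _)%MS; last first.
      by apply/sp_subP => m; rewrite !inE => /lE; apply: ker.
    by rewrite -(mxrank_leqif_sup (spS z (subsetT _))).2 -!mrkE z4 z3.
  move=> /sp_subP h m; have /sub_kermxP := h m (in_setT m).
  by rewrite zG => /eqP; rewrite scalemx_eq0 (negbTE (N0 m)) orbF => /eqP.
have al0 : al = 0 by apply/rowP => l; rewrite (kE l).1 k_all mul0r mxE.
have be0 : be = 0 by apply/rowP => l; rewrite (kE l).2 k_all mul0r mxE.
have x0 : x = 0 by apply: (row_free_inj fA); rewrite mul0mx.
have y0 : y = 0 by apply: (row_free_inj fA); rewrite mul0mx.
by move: u0; rewrite uE x0 y0 row_mx0 eqxx.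
Qed.

(** If no multiplier [k i] vanishes, the linear map [g] suffices. Otherwise just one vanishes: [g]
    is perturbed by [t *: h], where [h] sends that point to its target, and the factor [t] is scaled
    away. *)
Lemma lim_rank2_distinct z N : simple_big (mrk z) -> (forall i, row i z != 0) ->
  (forall i, row i N != 0) -> (mrk N setT <= 2)%N ->
  (forall i j, i != j -> mrk N [set i; j] = 2) -> lim (orbm z) N.
Proof.
move=> big z0 N0 rN N2; have [g [k [kE k0]]] := rank3_to_rank2 big N0 rN N2.
have [i0 ki0|none] := pickP (fun i => k i == 0); last first.
  apply: lim_orbm (lim_linear z g) _; apply: orbm_rowP; exists (fun i => (k i)^-1), 1%:M.
  split=> [i||i]; [by rewrite invr_eq0 none|exact: unitmx1|].
  by rewrite mulmx1 row_mul kE scalerA mulVf ?none // scale1r.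
pose h := pinvmx (row i0 z) *m row i0 N.
have hE : row i0 z *m h = row i0 N.
  by rewrite mulmxA mulmxVp ?mul1mx // /row_free rank_rV z0.
pose c t := \matrix_i (if i == i0 then row i N else k i *: row i N + t *: (row i z *m h)).
have c0 : lim (orbm z) (c 0).
  apply: (@lim_curve _ _ c 'X).
  - move=> i j; apply: (@polyf_ext _ (fun t => if i == i0 then N i j else
       k i * N i j + t * (row i z *m h) 0 j)).
      by move=> t; rewrite /c !mxE; case: ifP => _; rewrite !mxE.
    case: (i == i0); first exact: polyf_cst.
    apply: polyf_add; first exact: polyf_cst.
    by apply: polyf_mul; [exact: polyf_id | exact: polyf_cst].
  - by rewrite polyX_eq0.
  move=> t; rewrite /root hornerX => t0.
  apply: lim_orbm (lim_linear z (g + t *: h)) _; apply: orbm_rowP.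
  exists (fun i => if i == i0 then t^-1 else 1), 1%:M; split=> [i||i].
  - by case: ifP; rewrite ?invr_eq0 ?oner_eq0.
  - exact: unitmx1.
  rewrite rowK mulmx1 row_mul mulmxDr -scalemxAr kE; case: eqP => [->|_]; last by rewrite scale1r.
  by rewrite (eqP ki0) scale0r add0r hE scalerA mulVf // scale1r.
apply: lim_orbm c0 _; apply: orbm_rowP.
exists (fun i => if i == i0 then 1 else (k i)^-1), 1%:M; split=> [i||i].
- have [_|ii] := eqVneq i i0; first exact: oner_neq0.
  by rewrite invr_eq0 (k0 i0) 1?eq_sym //; apply/eqP.
- exact: unitmx1.
rewrite mulmx1 rowK scale0r addr0; have [_|ii] := eqVneq i i0; first by rewrite scale1r.
by rewrite scalerA mulVf ?scale1r // (k0 i0) 1?eq_sym //; apply/eqP.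
Qed.

Lemma five_points_on_line : exists N, [/\ forall i, row i N != 0, (mrk N setT <= 2)%N
  & forall i j, i != j -> mrk N [set i; j] = 2].
Proof.
(* The points (1 : 0) to (1 : 4) of a line are distinct in characteristic 0. *)
pose A : 'M[F]_(5, 2) := \matrix_(i, j) if j == 0 then 1 else (i : nat)%:R.
pose P : 'M[F]_(2, 2 + 2) := row_mx 1%:M 0.
pose N : 'M[F]_(5, 4) := A *m P.
have fP : row_free P.
  apply/row_freeP; exists (col_mx 1%:M 0); by rewrite /P mul_row_col mul1mx mul0mx addr0.
have NE i : row i N = row i A *m P by rewrite /N row_mul.
have N0 i : row i N != 0.
  rewrite NE; apply/eqP => E; have {E} : row i A = 0 by apply: (row_free_inj fP); rewrite mul0mx.
  by move/rowP/(_ 0)/eqP; rewrite !mxE oner_eq0.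
have rN : (mrk N setT <= 2)%N.
  rewrite mrkE; apply: leq_trans (mxrankS (_ : _ <= P)%MS) (rank_leq_row P).
  by apply/sp_subP => i _; rewrite NE submxMl.
exists N; split=> // i j ij; apply/eqP; rewrite eqn_leq (leq_trans (mrk_mono N (subsetT _)) rN) /=.
rewrite ltnNge; apply/negP => le; have [a] := parallel_row (N0 j) le.
rewrite !NE scalemxAl => /(row_free_inj fP)/rowP E.
have := E 0; rewrite !mxE /= mulr1 => a1.
have := E 1; rewrite !mxE /= -a1 mul1r => /natr_inj_char0/val_inj ij'.
by rewrite ij' eqxx in ij.
Qed.

Lemma mrk_nz M N : mrk M = mrk N -> (forall i, row i N != 0) -> forall i, row i M != 0.
Proof.
move=> E N0 i; have := congr1 (fun f : setfun 'I_5 => f [set i]) E.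
by rewrite !mrkE !sp1 !rank_rV N0; case: (row i M != 0).
Qed.

(** Five distinct points on a line have the largest rank function of rank 2, so [M] is a limit of
    such configurations, which are handled by [lim_rank2_distinct]. *)
Lemma lim_rank2 z M : simple_big (mrk z) -> (forall i, row i z != 0) ->
  (forall i, row i M != 0) -> (mrk M setT <= 2)%N -> lim (orbm z) M.
Proof.
move=> big z0 M0 rM; have [N [N0 rN N2]] := five_points_on_line.
have le I : (mrk M I <= mrk N I)%N.
  have [->|[i iI]] := set_0Vmem I; first by rewrite !mrk0.
  have [sub|/subsetPn[j jI ji]] := boolP (I \subset [set i]).
    have -> : I = [set i] by apply/eqP; rewrite eqEsubset sub sub1set.
    by rewrite !mrkE !sp1 !rank_rV M0 N0.
  apply: leq_trans (mrk_mono M (subsetT I)) (leq_trans rM _).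
  apply: leq_trans (_ : mrk N [set i; j] <= _)%N; first by rewrite N2 // eq_sym -in_set1.
  by apply: mrk_mono; rewrite subUset !sub1set iI.
apply: lim_lim (lim_below M0 le N0 erefl) => P PE; apply: lim_rank2_distinct => //.
- exact: mrk_nz PE N0.
- by rewrite PE.
- by move=> i j ij; rewrite PE N2.
Qed.

(** As row [i] is independent of the others, a linear map can fix the others and send row [i]
    anywhere. *)
Lemma lim_move z i (u : 'rV[F]_4) : ~~ (row i z <= sp z (~: [set i]))%MS ->
  lim (orbm z) (\matrix_j if j == i then u else row j z).
Proof.
move=> zi; pose W := sp z (~: [set i]); pose v := row i z.
have dis : (W :&: <<v>> = 0)%MS.
  apply/eqP; rewrite -submx0; apply/rV_subP => w; rewrite sub_capmx genmxE => /andP[wW /sub_rVP[a E]].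
  have [a0|a0] := eqVneq a 0; first by rewrite E a0 scale0r sub0mx.
  by move: zi; rewrite -/W -/v -(eqmx_scale _ a0) -E wW.
have v0 : v != 0 by apply: contraNneq zi => E; rewrite -/v E sub0mx.
pose g := proj_mx W <<v>>%MS + proj_mx <<v>>%MS W *m (pinvmx v *m u).
have -> : \matrix_j (if j == i then u else row j z) = z *m g.
  apply/row_matrixP => j; rewrite rowK row_mul mulmxDr mulmxA; case: eqVneq => [->|ji].
    rewrite proj_mx_0 ?genmxE // add0r proj_mx_id ?genmxE // 1?capmxC //.
    by rewrite mulmxA mulmxVp ?mul1mx // /row_free rank_rV v0.
  have jW : (row j z <= W)%MS by apply: row_sp; rewrite !inE.
  by rewrite proj_mx_id // proj_mx_0 // 1?capmxC // mul0mx addr0.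
exact: lim_linear.
Qed.

(** In rank at most 2 a nonempty set has rank 1 or 2, and rank 1 is detected on pairs. *)
Lemma ranklike_pairs (phi psi : setfun 'I_5) : ranklike phi -> ranklike psi ->
  (phi setT <= 2)%N -> (psi setT <= 2)%N ->
  (forall a b, (phi [set a; b] <= 1)%N = (psi [set a; b] <= 1)%N) -> phi = psi.
Proof.
move=> r1 r2 le1 le2 E; apply/ffunP => I.
have [->|[i iI]] := set_0Vmem I; first by case: r1 => ->; case: r2 => ->.
have gt0 f : ranklike f -> (0 < f I)%N.
  move=> r; have [_ f1 _ _ _] := r; have := @ranklike_mono _ r [set i] I.
  by rewrite f1 sub1set; apply.
have le f : ranklike f -> (f setT <= 2)%N -> (f I <= 2)%N.
  by move=> r; apply: leq_trans; apply: ranklike_mono => //; apply: subsetT.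
have pr f : ranklike f -> (f I <= 1)%N -> forall a b, a \in I -> b \in I -> (f [set a; b] <= 1)%N.
  move=> r h a b aI bI; apply: leq_trans h; apply: ranklike_mono => //.
  by rewrite subUset !sub1set aI.
have e : (phi I <= 1)%N = (psi I <= 1)%N.
  apply/idP/idP => /pr h; apply: pairs_rank1 => // a b aI bI; first by rewrite -E h.
  by rewrite E h.
have := le _ r1 le1; have := le _ r2 le2; have := gt0 _ r1; have := gt0 _ r2; move: e.
by case: (phi I) => [|[|[|]]] //; case: (psi I) => [|[|[|]]].
Qed.

Lemma parallel_trans (psi : setfun 'I_5) a b c : ranklike psi ->
  (psi [set a; b] <= 1)%N -> (psi [set b; c] <= 1)%N -> (psi [set a; c] <= 1)%N.
Proof.
move=> r ab bc; have [_ p1 _ _ pS] := r.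
rewrite -(leq_add2r 1); apply: leq_trans (leq_add ab bc); apply: leq_trans (pS _ _).
apply: leq_add; first by apply: ranklike_mono => //; rewrite subUset !sub1set !inE !eqxx ?orbT.
have := @ranklike_mono _ r [set b] ([set a; b] :&: [set b; c]).
by rewrite p1 sub1set !inE !eqxx ?orbT; apply.
Qed.

Lemma parallelE M a b : (forall i, row i M != 0) -> (mrk M [set a; b] <= 1)%N = (row a M <= row b M)%MS.
Proof.
move=> M0; have <- : (row a M <= sp M [set b])%MS = (row a M <= row b M)%MS by rewrite sp1.
rewrite -mrk_mem; have -> : mrk M [set b] = 1 by rewrite mrkE sp1 rank_rV M0.
apply/idP/eqP => [h|-> //]; apply/eqP; rewrite eqn_leq h /=.
have := mrk_mono M (subsetUr [set a] [set b]).
by rewrite [mrk M [set b]]mrkE sp1 rank_rV M0.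
Qed.

(** The independent point [i] is moved into the span of the others: onto a point parallel to it in
    [psi] if there is one, otherwise to a position different from all other points. *)
Lemma lim_block z i (psi : setfun 'I_5) : (forall j, row j z != 0) -> ranklike psi ->
  mrk z (~: [set i]) = 2 -> mrk z setT = 3 -> psi setT = 2 ->
  (forall I : {set 'I_5}, i \notin I -> psi I = mrk z I) ->
  exists M, [/\ lim (orbm z) M, forall j, row j M != 0 & mrk M = psi].
Proof.
move=> z0 rpsi z2 z3 psi2 psiE.
have zi : ~~ (row i z <= sp z (~: [set i]))%MS by rewrite -mrk_mem (setUCr [set i]) z2 z3.
suff [u [u0 uW uE]] : exists u : 'rV[F]_4, [/\ u != 0, (u <= sp z (~: [set i]))%MS &
    forall j, j != i -> (psi [set i; j] <= 1)%N = (row j z <= u)%MS].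
  pose M := \matrix_j if j == i then u else row j z.
  have rM j : row j M = if j == i then u else row j z by rewrite rowK.
  have M0 j : row j M != 0 by rewrite rM; case: ifP.
  exists M; split=> //; first exact: lim_move.
  have rk := mrk_ranklike M0.
  have MT : (mrk M setT <= 2)%N.
    rewrite -[X in (_ <= X)%N]z2 mrkE mrkE; apply: mxrankS; apply/sp_subP => j _.
    by rewrite rM; case: eqP => // /eqP ji; apply: row_sp; rewrite !inE.
  have iE b : b != i -> (mrk M [set i; b] <= 1)%N = (psi [set i; b] <= 1)%N.
    by move=> bi; rewrite uE // setUC parallelE // !rM eqxx (negbTE bi).
  have pairs a b : (mrk M [set a; b] <= 1)%N = (psi [set a; b] <= 1)%N.
    have [->|ai] := eqVneq a i.
      have [->|bi] := eqVneq b i; last exact: iE.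
      by have [_ p1 _ _ _] := rpsi; have [_ m1 _ _ _] := rk; rewrite setUid p1 m1.
    have [->|bi] := eqVneq b i; first by rewrite setUC iE.
    rewrite psiE ?inE ?negb_or 1?eq_sym ?ai 1?eq_sym // !parallelE // !rM.
    by rewrite (negbTE ai) (negbTE bi).
  by apply: ranklike_pairs => //; rewrite psi2.
have [j /andP[ji pj]|none] := pickP (fun j => (j != i) && (psi [set i; j] <= 1)%N).
  exists (row j z); split=> // [|l li]; first by apply: row_sp; rewrite !inE.
  rewrite -parallelE // -psiE ?inE ?negb_or 1?eq_sym ?li 1?eq_sym //.
  apply/idP/idP => h; first by apply: (@parallel_trans _ l i) => //; rewrite setUC.
  by apply: (@parallel_trans _ i j) => //; rewrite setUC.
have [a [b [ai bi ab]]] : exists a b, [/\ a != i, b != i & mrk z [set a; b] = 2].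
  have [[a b] /= /and3P[ai bi h]|h] := pickP (fun p => [&& p.1 != i, p.2 != i & mrk z [set p.1; p.2] == 2]).
    by exists a, b; split=> //; apply/eqP.
  suff : (mrk z (~: [set i]) <= 1)%N by rewrite z2.
  apply: pairs_rank1 => [|a b]; first exact: mrk_ranklike.
  rewrite !inE => ai bi; have := h (a, b); rewrite /= ai bi /= => /negbT.
  have := mrk_card z [set a; b]; rewrite cards2 => le ne.
  by move: le ne; case: (mrk z _) => [|[|[|]]] //; case: (a != b).
(* Each point [j] forbids at most one parameter on the line through [a] and [b]. If the coefficient
   [p] is zero, no parameter is forbidden and [q / p] is a harmless value. *)
have ex j : exists tau : F, j != i -> forall t, t != tau -> ~~ (row j z <= (row a z + t *: row b z)%R)%MS.
  have [->|ji] := eqVneq j i; first by exists 0.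
  have : (row j z <= row a z + row b z)%MS.
    have <- : (row j z <= sp z [set a; b])%MS = (row j z <= row a z + row b z)%MS.
      by rewrite sp2.
    have : (sp z [set a; b] <= sp z (~: [set i]))%MS.
      by apply: spS; rewrite subUset !sub1set !inE ai bi.
    move=> h; have : (sp z (~: [set i]) <= sp z [set a; b])%MS.
      by rewrite -(mxrank_leqif_sup h).2 -!mrkE ab z2.
    by apply: submx_trans; apply: row_sp; rewrite !inE.
  case/sub_addsmxP => -[p q] /=.
  rewrite (mx11_scalar p) (mx11_scalar q) !mul_scalar_mx; move: (p 0 0) (q 0 0) => {}p {}q E.
  exists (q / p) => _ t; apply: contraNN => /sub_rVP[k Ek].
  have [] := @pair_indep z a b (p - k) (q - k * t) ab.
    by rewrite !scalerBl addrACA -E Ek scalerDr scalerA -opprD subrr.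
  move=> /eqP; rewrite subr_eq0 => /eqP pk /eqP; rewrite subr_eq0 => /eqP ->.
  rewrite pk mulrC mulKf //; apply: contraNneq (z0 j) => k0.
  by rewrite Ek k0 scale0r.
have [tau tauP] := fin_all_exists ex.
have [t tn] := fresh_element [seq tau j | j <- enum 'I_5].
have tj j : t != tau j by apply: contraNneq tn => ->; apply: map_f; rewrite mem_enum.
exists (row a z + t *: row b z); split.
- apply/eqP => E; have [] := @pair_indep z a b 1 t ab; first by rewrite scale1r.
  by move/eqP; rewrite oner_eq0.
- by rewrite addmx_sub ?scalemx_sub //; apply: row_sp; rewrite !inE.
move=> j ji; rewrite (negbTE (tauP j ji t (tj j))); apply/negbTE.
by have := none j; rewrite ji /= => ->.
Qed.

End Wild.

(** * Multihomogeneous equations *)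

Section Polynomials.
Variable F : fieldType.
Hypothesis charF : [pchar F] =i pred0.
Implicit Types M N z : 'M[F]_(5, 4).

Definition evalm (p : {mpoly F[5 * 4]}) M : F := p.@[fun k => mxvec M 0 k].

Lemma nonroot (q : {poly F}) : q != 0 -> exists t, ~~ root q t.
Proof.
move=> q0; pose r := [seq n%:R : F | n <- iota 0 (size q)].
have ur : uniq r by rewrite map_inj_uniq ?iota_uniq //; apply: natr_inj_char0.
have [h|/allPn[t _ ?]] := boolP (all (root q) r); last by exists t.
by have := max_poly_roots q0 h ur; rewrite size_map size_iota ltnn.
Qed.

Lemma polyf_vanish (h : F -> F) (q : {poly F}) t0 : polyf h -> q != 0 ->
  (forall t, ~~ root q t -> h t = 0) -> h t0 = 0.
Proof.
case=> P hE q0 h0; suff P0 : P = 0 by rewrite hE P0 horner0.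
apply/eqP/negPn/negP => P0; have [t] := nonroot (mulf_neq0 P0 q0).
by rewrite rootM negb_or => /andP[/negP Pt qt]; apply: Pt; rewrite /root -hE h0.
Qed.

Lemma polyf_evalm p (c : F -> 'M[F]_(5, 4)) : pmx c -> polyf (fun t => evalm p (c t)).
Proof.
move=> pc; apply: (@polyf_ext _ (fun t => \sum_(m <- msupp p)
    p@_m * \prod_i mxvec (c t) 0 i ^+ m i)); first by move=> t; rewrite /evalm mevalE.
apply: polyf_sum => m; apply: polyf_mul; first exact: polyf_cst.
apply: polyf_prod => i; elim: (m i) => [|k IH].
  by apply: (@polyf_ext _ (fun=> 1)) => [t|]; [rewrite expr0 | exact: polyf_cst].
apply: (@polyf_ext _ (fun t => mxvec (c t) 0 i * mxvec (c t) 0 i ^+ k)); first by move=> t; rewrite exprS.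
apply: polyf_mul => //; case/mxvec_indexP: i {IH} => i j.
by apply: (@polyf_ext _ (fun t => c t i j)) => [t|]; [rewrite mxvecE | exact: pc].
Qed.

(** Along a curve the value is a polynomial in [t] vanishing off the roots of [q]; in characteristic
    0 there are enough such [t] to make it zero. *)
Lemma lim_evalm (A : 'M[F]_(5, 4) -> Prop) p M : (forall N, A N -> evalm p N = 0) -> lim A M ->
  evalm p M = 0.
Proof.
move=> h; elim=> {M} [M /h //|c q pc q0 _ IH].
exact: (polyf_vanish 0 (polyf_evalm p pc) q0 IH).
Qed.

Definition mdegs (d : 'I_5 -> nat) (p : {mpoly F[5 * 4]}) : Prop :=
  forall m : 'X_{1..5 * 4}, m \in msupp p -> forall i : 'I_5, (\sum_(j < 4) m (mxvec_index i j))%N = d i.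

(** Working with values on matrices makes determinants available. The degree is explicit because
    sums require equal degrees. *)
Definition mhom (d : 'I_5 -> nat) (f : 'M[F]_(5, 4) -> F) : Prop :=
  exists2 p, mdegs d p & forall M, f M = evalm p M.

Lemma mhom_ext d d' f f' : d =1 d' -> f =1 f' -> mhom d f -> mhom d' f'.
Proof. by move=> Ed Ef [p dp E]; exists p => [m mp i|M]; rewrite -?Ed -?Ef //; apply: dp. Qed.

Lemma mhom_cst a : mhom (fun=> 0%N) (fun=> a).
Proof.
exists a%:MP => [m|M]; last by rewrite /evalm mevalC.
rewrite msuppC; case: eqP => // _; rewrite inE => /eqP -> i.
by apply: big1 => j _; rewrite mnm0E.
Qed.

Lemma mhom0 d : mhom d (fun=> 0).
Proof. by exists 0 => [m|M]; rewrite ?msupp0 // /evalm meval0. Qed.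

Lemma mhom_entry i j : mhom (fun k => nat_of_bool (k == i)) (fun M => M i j).
Proof.
exists 'X_(mxvec_index i j) => [m|M]; last by rewrite /evalm mevalXU mxvecE.
rewrite msuppX inE => /eqP -> k; rewrite (eq_bigr (fun l => nat_of_bool ((k == i) && (l == j)))).
  rewrite (bigD1 j) //= eqxx andbT big1 ?addn0 // => l /negbTE ->.
  by rewrite andbF.
move=> l _; rewrite mnm1E; congr (nat_of_bool _).
apply/eqP/andP => [E|[/eqP -> /eqP ->] //].
by move: E; rewrite /mxvec_index => /cast_ord_inj/enum_rank_inj[-> ->]; rewrite !eqxx.
Qed.

Lemma mhom_add d f g : mhom d f -> mhom d g -> mhom d (fun M => f M + g M).
Proof.
case=> p dp fE [q dq gE]; exists (p + q) => [m|M]; last by rewrite /evalm mevalD fE gE.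
by move=> /msuppD_le; rewrite mem_cat => /orP[/dp|/dq].
Qed.

Lemma mhom_mul d d' f g : mhom d f -> mhom d' g -> mhom (fun i => d i + d' i)%N (fun M => f M * g M).
Proof.
case=> p dp fE [q dq gE]; exists (p * q) => [m|M]; last by rewrite /evalm mevalM fE gE.
move=> /msuppM_le/allpairsP[[m1 m2] [/= m1p m2q ->]] i.
rewrite -(dp _ m1p i) -(dq _ m2q i) -big_split /=; apply: eq_bigr => j _.
by rewrite mnmDE.
Qed.

Lemma mhom_scale d a f : mhom d f -> mhom d (fun M => a * f M).
Proof. by move=> /(mhom_mul (mhom_cst a)); apply: mhom_ext. Qed.

Lemma mhom_sum (I : Type) (r : seq I) (P : pred I) d (f : I -> 'M[F]_(5, 4) -> F) :
  (forall i, mhom d (f i)) -> mhom d (fun M => \sum_(i <- r | P i) f i M).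
Proof.
move=> h; elim: r => [|i r IH].
  by apply: mhom_ext (mhom0 d) => // M; rewrite big_nil.
case Pi: (P i); last by apply: mhom_ext IH => // M; rewrite big_cons Pi.
by apply: mhom_ext (mhom_add (h i) IH) => // M; rewrite big_cons Pi.
Qed.

Lemma mhom_prod (I : Type) (r : seq I) (d : I -> 'I_5 -> nat) (f : I -> 'M[F]_(5, 4) -> F) :
  (forall i, mhom (d i) (f i)) -> mhom (fun k => \sum_(i <- r) d i k)%N (fun M => \prod_(i <- r) f i M).
Proof.
move=> h; elim: r => [|i r IH].
  by apply: mhom_ext (mhom_cst 1) => [k|M]; rewrite big_nil.
by apply: mhom_ext (mhom_mul (h i) IH) => [k|M]; rewrite big_cons.
Qed.

Lemma mhom_mul_row n (f : 'I_n -> 'I_5) (Y : 'M_(4, n)) k l :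
  mhom (fun i => nat_of_bool (i == f k)) (fun M => (rowsub f M *m Y) k l).
Proof.
apply: (@mhom_ext (fun i => nat_of_bool (i == f k)) _ (fun M => \sum_j Y j l * M (f k) j)) => //.
  by move=> M; rewrite mxE; apply: eq_bigr => j _; rewrite mxE mulrC.
by apply: mhom_sum => j; apply: mhom_scale; apply: mhom_entry.
Qed.

Lemma mhom_det n (f : 'I_n -> 'I_5) (Y : 'M_(4, n)) :
  mhom (fun i => \sum_k nat_of_bool (i == f k))%N (fun M => \det (rowsub f M *m Y)).
Proof.
apply: mhom_sum => s; apply: mhom_scale.
apply: (@mhom_prod _ _ (fun k i => nat_of_bool (i == f k))) => k.
exact: mhom_mul_row.
Qed.

Lemma minor_rank n (f : 'I_n -> 'I_5) (Y : 'M_(4, n)) M (I : {set 'I_5}) :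
  (forall k, f k \in I) -> \det (rowsub f M *m Y) != 0 -> (n <= mrk M I)%N.
Proof.
move=> fI; rewrite -unitfE -unitmxE -row_free_unit => /eqP <-.
apply: leq_trans (mxrankM_maxl _ _) _; rewrite mrkE; apply: mxrankS.
by apply/row_subP => k; rewrite row_rowsub; apply: row_sp.
Qed.

(** Together with [minor_rank], this detects ranks by multihomogeneous functions; the constant
    matrix [Y] takes the place of a choice of columns. *)
Lemma rank_minor M (I : {set 'I_5}) : exists (f : 'I_(mrk M I) -> 'I_5) (Y : 'M_(4, mrk M I)),
  (forall k, f k \in I) /\ \det (rowsub f M *m Y) != 0.
Proof.
rewrite mrk_mk; pose X := mk I M; pose f := maxrankfun X.
have fr : row_free (rowsub f X) := maxrowsub_free X.
have fI k : f k \in I.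
  apply: contraT => nI; have : row k (rowsub f X) = 0.
    by rewrite row_rowsub row_mk (negbTE nI) scale0r.
  rewrite rowE => E; have : (delta_mx 0 k : 'rV[F]_(\rank X)) = 0 by apply: (row_free_inj fr); rewrite mul0mx.
  by move/rowP/(_ k)/eqP; rewrite !mxE !eqxx oner_eq0.
exists f, (pinvmx (rowsub f X)); split=> //.
have -> : rowsub f M = rowsub f X.
  by apply/row_matrixP => k; rewrite !row_rowsub row_mk fI scale1r.
by rewrite mulmxVp // det1 oner_eq0.
Qed.

End Polynomials.

(** * Brackets and cross-ratio equations *)

Section Brackets.
Variable F : fieldType.
Hypothesis charF : [pchar F] =i pred0.
Implicit Types M N z : 'M[F]_(5, 4).
Implicit Types (e : option 'I_5) (a b c d x y : 'I_5).

(* The rows a, e, b (or a, b when [e = None]) in this order. *)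
Definition brow e a b (k : 'I_(isSome e).+2) : 'I_5 :=
  if k == ord_max then b else if k == 0 then a else odflt a e.

(** The matrix [Y] projects the 4-space to the dimension [rk2 e] of the minor, so that the
    determinant makes sense. *)
Definition bra e (Y : 'M[F]_(4, (isSome e).+2)) a b M : F := \det (rowsub (brow a b) M *m Y).

Lemma brow_in e a b (k : 'I_(isSome e).+2) : brow a b k \in eset e [:: a; b].
Proof.
rewrite /brow !inE; case: ifP => _; first by rewrite eqxx !orbT.
case: ifP => _; first by rewrite eqxx !orbT.
by case: e k => [i|] k /=; rewrite eqxx ?orbT.
Qed.

Lemma brow_surj e a b i : i \in eset e [:: a; b] -> exists k : 'I_(isSome e).+2, brow a b k = i.
Proof.
rewrite !inE => /or3P[/eqP <-|/eqP ->|/eqP ->].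
- by exists (Ordinal (isT : 1 < 3)%N).
- by exists 0; rewrite /brow eqxx; case: e.
- by exists ord_max; rewrite /brow eqxx.
Qed.

Lemma eset_card e s : (#|eset e s| <= isSome e + size s)%N.
Proof.
have -> : (isSome e + size s)%N = size (if e is Some i then i :: s else s) by case: e.
apply: leq_trans (card_size _); apply: subset_leq_card; apply/subsetP => i.
by rewrite !inE; case: e => [j|] //=; rewrite inE.
Qed.

Lemma bas_le M e a b : (rk2 e <= mrk M (eset e [:: a; b]))%N -> bas (mrk M) e a b.
Proof.
move=> h; rewrite /bas eqn_leq h andbT.
by apply: leq_trans (mrk_card _ _) _; apply: leq_trans (eset_card _ _) _; rewrite addn2.
Qed.

Lemma bra_bas e Y a b M : @bra e Y a b M != 0 -> bas (mrk M) e a b.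
Proof. by move=> h; apply: bas_le; apply: minor_rank h => k; apply: brow_in. Qed.

Lemma rank_frame m n (W : 'M[F]_(m, 4)) : \rank W = n ->
  exists (B : 'M_(n, 4)) (Y : 'M_(4, n)), B *m Y = 1%:M /\ (W <= B)%MS.
Proof.
move=> <-; exists (row_base W), (pinvmx (row_base W)).
by rewrite mulmxVp ?row_base_free // eq_row_base.
Qed.

Lemma bra_neq0 e (B : 'M[F]_((isSome e).+2, 4)) Y M (W : {set 'I_5}) x y :
  B *m Y = 1%:M -> (sp M W <= B)%MS -> eset e [:: x; y] \subset W ->
  bas (mrk M) e x y -> @bra e Y x y M != 0.
Proof.
move=> BY MB sub /eqP E; rewrite /bra -unitfE -unitmxE -row_free_unit.
have : (rowsub (@brow e x y) M <= B)%MS.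
  apply/row_subP => k; rewrite row_rowsub; apply: submx_trans MB; apply: row_sp.
  by apply: (subsetP sub); apply: brow_in.
case/submxP => C CE; rewrite CE -mulmxA BY mulmx1 /row_free eqn_leq rank_leq_row.
rewrite -[X in (X <= _)%N]E; apply: leq_trans (mxrankM_maxl C B); rewrite -CE mrkE; apply: mxrankS.
by apply/sp_subP => i /brow_surj[k <-]; rewrite -row_rowsub row_sub.
Qed.

Lemma sub_eset e s t : {subset s <= t} -> eset e s \subset eset e t.
Proof. by move=> h; apply/subsetP => i; rewrite !inE => /orP[->//|/h ->]; rewrite orbT. Qed.

(** On the span of the minor, changing [Y] multiplies all brackets by one common determinant, so the
    ratio of the two products is independent of [Y]. The constant [la] is a cross-ratio. *)
Lemma bra_ratio z e a b c d : U24 (mrk z) e a b c d -> exists2 la : F, la != 0 &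
  forall Y, @bra e Y a b z * bra Y c d z = la * (bra Y a c z * bra Y b d z).
Proof.
case/and5P => /eqP; rewrite {1}mrkE => /rank_frame[B [Y [BY zB]]] ab cd ac /and3P[bd _ _].
have nz x y : {subset [:: x; y] <= [:: a; b; c; d]} -> bas (mrk z) e x y -> bra Y x y z != 0.
  by move=> h; apply: bra_neq0 BY zB _; apply: sub_eset.
have scal Y' x y : {subset [:: x; y] <= [:: a; b; c; d]} ->
    @bra e Y' x y z = bra Y x y z * \det (B *m Y').
  move=> h; rewrite /bra -det_mulmx mulmxA; congr (\det (_ *m _)).
  have : (rowsub (@brow e x y) z <= B)%MS.
    apply/row_subP => k; rewrite row_rowsub; apply: submx_trans zB; apply: row_sp.
    by apply: (subsetP (sub_eset e h)); apply: brow_in.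
  by case/submxP => C ->; rewrite -!mulmxA (mulmxA B) BY mul1mx.
have s2 x y : x \in [:: a; b; c; d] -> y \in [:: a; b; c; d] -> {subset [:: x; y] <= [:: a; b; c; d]}.
  by move=> h h' i; rewrite !inE => /orP[]/eqP ->; move: h h'; rewrite !inE.
have [a4 b4 c4 d4] : [/\ a \in [:: a; b; c; d], b \in [:: a; b; c; d], c \in [:: a; b; c; d]
   & d \in [:: a; b; c; d]] by rewrite !inE !eqxx ?orbT.
exists (bra Y a b z * bra Y c d z / (bra Y a c z * bra Y b d z)).
  by rewrite !mulf_neq0 ?invr_neq0 ?mulf_neq0 ?nz //; apply: s2.
move=> Y'; rewrite !(scal Y') //; try exact: s2.
have := nz a c (s2 _ _ a4 c4) ac; have := nz b d (s2 _ _ b4 d4) bd.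
set u := bra Y a c z; set v := bra Y b d z; move: u v (\det _) (bra Y a b z) (bra Y c d z).
move=> u v D p q u0 v0; field; by rewrite u0 v0.
Qed.

Lemma bra_act e Y (s : 'rV[F]_5) M (g : 'M_4) a b :
  @bra e Y a b (diag_mx s *m M *m g) = (oapp (s 0) 1 e * s 0 a * s 0 b) * bra (g *m Y) a b M.
Proof.
have -> : oapp (s 0) 1 e * s 0 a * s 0 b = \det (diag_mx (\row_k s 0 (@brow e a b k))).
  rewrite det_diag; case: e Y => [i|] Y.
    rewrite !big_ord_recl big_ord0 /= !mxE mulr1 mulrA; congr (_ * _); rewrite mulrC //.
  by rewrite !big_ord_recl big_ord0 /= !mxE mulr1 mul1r.
rewrite /bra -det_mulmx !mulmxA; congr (\det (_ *m _)).
apply/row_matrixP => k; rewrite row_rowsub [in LHS]row_mul [in RHS]row_mul; congr (_ *m _).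
by rewrite !row_mul !row_diag_mx -!scalemxAl -!rowE row_rowsub mxE.
Qed.

Definition quadf e Y a b c d (la : F) M : F :=
  @bra e Y a b M * bra Y c d M - la * (bra Y a c M * bra Y b d M).

Lemma brow_degree e a b i :
  (\sum_(k < (isSome e).+2) nat_of_bool (i == brow a b k) =
   oapp (fun j => nat_of_bool (i == j)) 0 e + (i == a) + (i == b))%N.
Proof.
case: e => [j|]; rewrite !big_ord_recl big_ord0 /= addn0 ?add0n //.
by rewrite addnCA addnA.
Qed.

(** Both products contain each of the four points once and the apex twice, so the degrees agree. *)
Lemma quadf_mhom e Y a b c d la : exists deg, mhom deg (@quadf e Y a b c d la).
Proof.
exists (fun i => (\sum_(k < (isSome e).+2) nat_of_bool (i == brow a b k)) +
   \sum_(k < (isSome e).+2) nat_of_bool (i == brow c d k))%N.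
apply: (@mhom_ext _ _ _ (fun M => @bra e Y a b M * bra Y c d M + (- la) * (bra Y a c M * bra Y b d M))) => //.
  by move=> M; rewrite /quadf mulNr.
apply: mhom_add; first by apply: mhom_mul; apply: mhom_det.
apply: mhom_scale; apply: (@mhom_ext _ (fun i => (\sum_(k < (isSome e).+2) nat_of_bool (i == brow a c k)) +
   \sum_(k < (isSome e).+2) nat_of_bool (i == brow b d k))%N _ (fun M => bra Y a c M * bra Y b d M)) => //.
  by move=> i; rewrite !brow_degree -!addnA; congr addn; rewrite addnCA [in RHS]addnCA; lia.
by apply: mhom_mul; apply: mhom_det.
Qed.

(** The linear map is absorbed into [Y], and row scalings multiply both products by the same
    factor. *)
Lemma quadf_orbit z e a b c d la :
  (forall Y, @bra e Y a b z * bra Y c d z = la * (bra Y a c z * bra Y b d z)) ->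
  forall M Y, orbm z M -> @quadf e Y a b c d la M = 0.
Proof.
move=> E _ Y [s [g [_ _ ->]]]; rewrite /quadf !bra_act.
have := E (g *m Y); move: (bra _ a b _) (bra _ c d _) (bra _ a c _) (bra _ b d _) => u v w x E'.
set k := oapp _ _ _; rewrite (_ : _ - _ = (k * k * s 0 a * s 0 b * s 0 c * s 0 d) * (u * v - la * (w * x))).
  by rewrite E' subrr mulr0.
by ring.
Qed.

Fact lift_max_neq n (k : 'I_n) : lift ord_max k != ord_max :> 'I_n.+1.
Proof. by rewrite eq_sym neq_lift. Qed.

Lemma brow_init e x y y' (k : 'I_(isSome e).+2) : k != ord_max -> brow x y k = brow x y' k.
Proof. by rewrite /brow => /negbTE ->. Qed.

Lemma brow_neq e x y d (k : 'I_(isSome e).+2) : x != d -> y != d -> e != Some d -> brow x y k != d.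
Proof.
rewrite /brow => xd yd ed; case: ifP => // _; case: ifP => // _.
by case: e k ed => [j|] k //=; apply: contraNneq => ->.
Qed.

Definition move_row M d c (t : F) : 'M[F]_(5, 4) :=
  \matrix_j if j == d then row d M + t *: row c M else row j M.

Lemma bra_move_out e Y M d c t x y : x != d -> y != d -> e != Some d ->
  @bra e Y x y (move_row M d c t) = bra Y x y M.
Proof.
move=> xd yd ed; congr (\det (_ *m _)); apply/row_matrixP => k.
by rewrite !row_rowsub rowK (negbTE (brow_neq _ xd yd ed)).
Qed.

Lemma bra_move e Y M d c t x : x != d -> c != d -> e != Some d ->
  @bra e Y x d (move_row M d c t) = bra Y x d M + t * bra Y x c M.
Proof.
move=> xd cd ed; rewrite /bra -[X in X + _]mul1r.
apply: (determinant_multilinear (i0 := ord_max)).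
- by rewrite !row_mul !row_rowsub /brow eqxx rowK eqxx scale1r mulmxDl scalemxAl.
- apply/matrixP => k l; rewrite !mxE; apply: eq_bigr => j _; rewrite !mxE.
  rewrite (brow_init x d c (lift_max_neq k)) (negbTE (brow_neq _ xd cd ed)).
  by rewrite mxE.
- apply/matrixP => k l; rewrite !mxE; apply: eq_bigr => j _; rewrite !mxE.
  rewrite [in RHS](brow_init x d c (lift_max_neq k)) (negbTE (brow_neq _ xd cd ed)).
  by rewrite mxE.
Qed.

(* Moving [d] towards [c] keeps the rank function but changes the cross-ratio. *)
Lemma quadf_moves M e a b c d : U24 (mrk M) e a b c d -> freeto (mrk M) d c ->
  exists M', mrk M' = mrk M /\
    forall la : F, la != 0 -> (forall Y, @quadf e Y a b c d la M = 0) ->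
      ~ forall Y, @quadf e Y a b c d la M' = 0.
Proof.
move=> /and5P[/eqP rk ab cd ac /and3P[bd ad bc]] fr.
have dist x y : bas (mrk M) e x y -> x != y /\ e != Some y.
  move=> /eqP E; split; apply/eqP => h.
    have := leq_trans (mrk_card M (eset e [:: x])) (eset_card _ _).
    rewrite /= addn1 (_ : eset e [:: x] = eset e [:: x; y]) ?E /rk2 ?ltnn //.
    by apply/setP => i; rewrite !inE -h orbb.
  have Es : eset None [:: x; y] = eset e [:: x; y].
    apply/setP => i; rewrite !inE h (_ : (Some i == Some y) = (i == y)) //.
    by case: (i == x); case: (i == y).
  have := leq_trans (mrk_card M (eset None [:: x; y])) (eset_card _ _).
  by rewrite Es E h.
have [cd' ed] := dist _ _ cd; have [bd' _] := dist _ _ bd; have [ad' _] := dist _ _ ad.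
pose cv t := move_row M d c t.
have c0 : cv 0 = M.
  apply/row_matrixP => j; rewrite rowK scale0r addr0; by case: eqP => [->|].
have pcv : pmx cv.
  move=> i j; apply: (@polyf_ext _ (fun t => if i == d then M d j + t * M c j else M i j)).
    by move=> t; rewrite !mxE; case: ifP => _; rewrite !mxE.
  case: (i == d); last exact: polyf_cst.
  apply: polyf_add; first exact: polyf_cst.
  by apply: polyf_mul; [exact: polyf_id | exact: polyf_cst].
have [q q0 qE] := semicont 0 pcv; rewrite c0 in qE.
have [t] := nonroot charF (mulf_neq0 q0 (negbT (polyX_eq0 F))).
rewrite rootM negb_or rootX => /andP[/qE ge t0].
(* If [d] depends on the rest of [I], so does [c] by [freeto], and hence the moved row. Otherwise
   the rank of [M] is already the largest that one additional row allows. *)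
have le I : (mrk (cv t) I <= mrk M I)%N.
  have same (I' : {set 'I_5}) : d \notin I' -> sp (cv t) I' = sp M I'.
    move=> dI; apply: eq_bigr => j jI; rewrite rowK; case: eqP => // jd; by rewrite -jd jI in dI.
  have [dI|dI] := boolP (d \in I); last by rewrite !mrkE same.
  have [E|ne] := eqVneq (mrk M (d |: I :\ d)) (mrk M (I :\ d)); last first.
    have -> : mrk M I = (mrk M (I :\ d)).+1.
      move: ne (mrk_U1 M d (I :\ d)); rewrite (setD1K dI) => ne /andP[h1 h2].
      by apply/eqP; rewrite eqn_leq h2 ltn_neqAle eq_sym ne.
    rewrite -[I in (mrk (cv t) I <= _)%N](setD1K dI).
    have /andP[_] := mrk_U1 (cv t) d (I :\ d).
    by rewrite [mrk (cv t) (I :\ d)]mrkE same ?mrkE // !inE eqxx.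
  have := fr (I :\ d); rewrite !inE eqxx /= => /(_ isT E)/eqP; rewrite mrk_mem => cI.
  move/eqP: E; rewrite mrk_mem => dM.
  apply: leq_trans (mrk_mono M (subsetDl I [set d])); apply: mrk_le_sub.
  apply/sp_subP => j jI; rewrite rowK; case: eqP => [_|/eqP jd].
    by rewrite addmx_sub ?scalemx_sub.
  by apply: row_sp; rewrite !inE jd.
exists (cv t); split.
  by apply/ffunP => I; apply/eqP; rewrite eqn_leq le ge.
move=> la la0 hM hM'.
have [B [Y [BY MB]]] := rank_frame (etrans (esym (mrkE M _)) rk).
have nz x y : {subset [:: x; y] <= [:: a; b; c; d]} -> bas (mrk M) e x y -> bra Y x y M != 0.
  by move=> h; apply: bra_neq0 BY MB _; apply: sub_eset.
have cc : bra Y c c M = 0.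
  apply/eqP/negPn/negP => /bra_bas /dist[]; by rewrite eqxx.
have := hM' Y; rewrite /quadf !(bra_move_out _ _ _ _ ad') // !(bra_move _ _ _ bd') // !(bra_move _ _ _ cd') //.
(* Subtracting the equation at [M] leaves, up to sign, the product of [la], [t] and the brackets of
   [a, c] and [b, c], none of which is zero. *)
rewrite cc mulr0 addr0 mulrDr mulrDr opprD addrA -/(quadf Y a b c d la M) hM add0r => /eqP.
have bc4 : {subset [:: b; c] <= [:: a; b; c; d]}.
  by move=> i; rewrite !inE => /orP[]->; rewrite !orbT.
have ac4 : {subset [:: a; c] <= [:: a; b; c; d]}.
  by move=> i; rewrite !inE => /orP[]->; rewrite ?orbT.
by rewrite oppr_eq0 !mulf_eq0 (negbTE la0) (negbTE t0) (negbTE (nz _ _ ac4 ac)) (negbTE (nz _ _ bc4 bc)).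
Qed.

End Brackets.

(** * Configurations *)

Section Configurations.
Variable K : fieldType.
Hypothesis charK : [pchar K] =i pred0.
Implicit Types (M N : 'M[K]_(5, 4)) (x y : config K).

Definition repr_by M x : Prop := forall i, val (x i) = <[row i M]>%VS.

Lemma P3_vector (U : P3 K) : exists v : 'rV[K]_4, val U = <[v]>%VS.
Proof.
case: U => U /= /eqP dU; exists (vpick U); apply/esym/eqP.
rewrite eqEdim dU dim_vline vpick0 -dimv_eq0 dU /= andbT.
by rewrite -memvE memv_pick.
Qed.

Lemma repr_exists x : exists M, repr_by M x.
Proof.
have [v vE] := fin_all_exists (fun i => P3_vector (x i)).
by exists (\matrix_i v i) => i; rewrite rowK.
Qed.

Lemma repr_neq0 M x : repr_by M x -> forall i, row i M != 0.
Proof.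
move=> h i; have := valP (x i); rewrite /= h dim_vline; by case: (row i M != 0).
Qed.

Lemma config_exists M : (forall i, row i M != 0) -> exists x, repr_by M x.
Proof.
move=> M0; have d1 i : \dim <[row i M]>%VS == 1%N by rewrite dim_vline M0.
by exists [ffun i => exist _ <[row i M]>%VS (d1 i)] => i; rewrite ffunE.
Qed.

Lemma line_eq (u v : 'rV[K]_4) : u != 0 -> (<[u]> = <[v]>)%VS -> exists2 s, s != 0 & u = s *: v.
Proof.
move=> u0 E; have /vlineP[s us] : u \in <[v]>%VS by rewrite -E memv_line.
by exists s => //; apply: contraNneq u0 => s0; rewrite us s0 scale0r.
Qed.

Lemma line_scale (s : K) (v : 'rV[K]_4) : s != 0 -> (<[s *: v]> = <[v]>)%VS.
Proof.
move=> s0; apply/eqP; rewrite eqEsubv -!memvE memvZ ?memv_line //=.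
by rewrite -[v in v \in _](scalerK s0) memvZ ?memv_line.
Qed.

Lemma repr_scale M N x : repr_by M x -> repr_by N x ->
  exists2 s : 'rV[K]_5, (forall i, s 0 i != 0) & N = diag_mx s *m M.
Proof.
move=> hM hN; have ex i : exists s, s != 0 /\ row i N = s *: row i M.
  have [|s s0 E] := @line_eq (row i N) (row i M) (repr_neq0 hN i); first by rewrite -hM -hN.
  by exists s.
have [s sE] := fin_all_exists ex.
exists (\row_i s i) => [i|]; first by rewrite mxE; case: (sE i).
by apply/row_matrixP => i; rewrite row_mul row_diag_mx -scalemxAl -rowE mxE; case: (sE i).
Qed.

Lemma repr_orbit M N x y : repr_by M x -> repr_by N y -> GL_orbit x y <-> orbm M N.
Proof.
move=> hM hN; split=> [[g ug E]|[s [g [s0 ug E]]]].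
  have ex i : exists s, s != 0 /\ row i N = s *: (row i M *m g).
    have [|s s0 E'] := @line_eq (row i N) (row i M *m g) (repr_neq0 hN i).
      by rewrite -hN E hM limg_line lfunE.
    by exists s.
  have [s sE] := fin_all_exists ex.
  by apply: orbm_rowP; exists s, g; split=> // i; case: (sE i).
exists g => // i; rewrite hN hM limg_line lfunE /= E row_act.
by rewrite line_scale.
Qed.

Import VectorInternalTheory.

(** The dimension of a [vspace] is computed in the coordinates [v2r], which differ from the given
    ones by the injective linear map [H]. *)
Lemma dim_span_rank n (v : 'I_n -> 'rV[K]_4) (I : {set 'I_n}) :
  \dim (\sum_(i in I) <[v i]>)%VS = \rank (\sum_(i in I) <<v i>>)%MS.
Proof.
pose H := lin1_mx (@v2r K 'rV[K]_4).
have HE u : u *m H = v2r u by rewrite mul_rV_lin1.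
have fH : row_free H.
  by apply: inj_row_free => u; rewrite HE => /(canRL v2rK) ->; rewrite linear0.
have E : (vs2mx (\sum_(i in I) <[v i]>)%VS :=: \sum_(i in I) <<v2r (v i)>>)%MS.
  elim/big_rec2: _ => [|i A U _ h].
    by apply: eqmx_trans (mx2vsK _) _; rewrite linear0; apply: eqmx0.
  apply: eqmx_trans (mx2vsK _) _; apply: adds_eqmx h.
  by apply: eqmx_trans (mx2vsK _) (eqmx_sym (genmxE _)).
rewrite /dimv E -(mxrankMfree _ fH) sumsmxMr_gen.
congr (\rank _); apply: eq_bigr => i _; apply/genmxP.
by rewrite -HE; apply/eqmxP/eqmxMr/eqmx_sym/genmxE.
Qed.

Lemma span_dim_mrk M x : repr_by M x -> span_dim x = mrk M.
Proof.
move=> h; apply/ffunP => I; rewrite mrkE ffunE -dim_span_rank.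
by congr (\dim _); apply: eq_bigr => i _; rewrite h.
Qed.

End Configurations.

Lemma rho_block (phi : setfun 'I_5) P B : ranklike phi -> rho_partition phi P -> B \in P ->
  [/\ B != set0, separator phi B & ~~ decomposable phi B].
Proof.
move=> [phi0 _ _ _ _] /and3P[/and3P[_ /trivIsetP tr P0] /forallP sm /forallP dc] BP; split.
- by apply: contraNneq P0 => <-.
- move=> I; have /eqP -> := sm I; have /eqP -> := sm (I :\: B).
  rewrite (bigD1 B) //= [in RHS](bigD1 B) //=.
  have -> : (I :\: B) :&: B = set0 by apply/setP => x; rewrite !inE; case: (x \in B); rewrite ?andbF.
  rewrite phi0 add0n; congr (_ + _)%N; apply: eq_bigr => C /andP[CP CB]; congr (phi _).
  apply/setP => x; rewrite !inE; case: (boolP (x \in B)) => //= xB.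
  have := tr B C BP CP; rewrite eq_sym CB => /(_ isT)/disjointFr/(_ xB) ->.
  by rewrite andbF.
- by have /implyP/(_ BP) := dc B.
Qed.

(** * The order relations and limits of orbits *)

Section Degenerations.
Variable K : fieldType.
Hypothesis charK : [pchar K] =i pred0.
Implicit Types (M N z : 'M[K]_(5, 4)) (phi psi chi : setfun 'I_5).

Definition realizes M phi : Prop := (forall i, row i M != 0) /\ mrk M = phi.

(** With iterated limits in place of the Zariski closure, [lim_meets] and [lim_covers] are the two
    conditions on a stratum in part (2). *)
Definition lim_meets z chi : Prop := exists2 M, realizes M chi & lim (orbm z) M.

Definition lim_covers z chi : Prop := forall M, realizes M chi -> lim (orbm z) M.

Lemma image_realizes phi : image_pi K phi <-> exists M, realizes M phi.
Proof.
split=> [[x _ <-]|[M [M0 <-]]].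
  by have [M hM] := repr_exists x; exists M; split; [exact: repr_neq0 hM | rewrite (span_dim_mrk hM)].
by have [x hx] := config_exists M0; exists x => //; apply: span_dim_mrk.
Qed.

Lemma realizes_ranklike M phi : realizes M phi -> ranklike phi.
Proof. by case=> M0 <-; apply: mrk_ranklike. Qed.

Lemma ranklike_realizes M phi : ranklike phi -> mrk M = phi -> realizes M phi.
Proof.
move=> [_ p1 _ _ _] E; split=> // i; have := p1 i; rewrite -E mrkE sp1 rank_rV.
by case: (row i M != 0).
Qed.

Lemma tame_covers z chi : tame chi -> lim_meets z chi -> lim_covers z chi.
Proof.
move=> t [M [M0 ME] LM] N [N0 NE]; apply: lim_orbm LM _; apply: tame_orbm; first by rewrite ME.
by rewrite ME.
Qed.

Lemma covers_below z chi M psi : (exists N, realizes N chi) -> lim_covers z chi ->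
  realizes M psi -> setfun_le psi chi -> lim (orbm z) M.
Proof.
move=> [N [N0 NE]] cov [M0 <-] le.
apply: lim_lim (lim_below M0 le N0 NE) => P PE; apply: cov; split=> //.
by apply: mrk_nz N0; rewrite PE.
Qed.

Lemma meets_realizes z chi : lim_meets z chi -> exists N, realizes N chi.
Proof. by case=> N; exists N. Qed.

Lemma meets_face z chi psi J : lim_meets z chi -> psi = face chi J -> ranklike psi -> lim_meets z psi.
Proof.
move=> [M [M0 ME] LM] E r; have [N [LN NE]] := lim_face J (mrk_ranklike M0).
exists N; last exact: lim_orbm_trans LM LN.
by apply: ranklike_realizes => //; rewrite E NE ME.
Qed.

(** Flatness of [J] keeps the points outside [J] nonzero after projection from its span. *)
Lemma face_ranklike chi J : (exists N, realizes N chi) -> flat chi J ->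
  ranklike (face chi J) /\ exists N, realizes N (face chi J).
Proof.
move=> [M [M0 ME]] fJ; have [N [_ NE]] := lim_face J (mrk_ranklike M0); rewrite ME in NE.
have r : ranklike chi by rewrite -ME; apply: mrk_ranklike.
have N0 i : row i N != 0.
  have [c0 c1 _ _ _] := r; have := faceE J [set i] r.
  rewrite -NE mrkE sp1 rank_rV; have [iJ|iJ] := boolP (i \in J).
    have -> : [set i] :|: J = J by apply/setUidPr; rewrite sub1set.
    have -> : [set i] :&: J = [set i] by apply/setIidPl; rewrite sub1set.
    by rewrite c1 addnC => /addnI; case: (row i N != 0).
  have -> : [set i] :&: J = set0 by apply/eqP; rewrite setI_eq0 disjoints1.
  rewrite c0 addn0 => E; have := fJ i iJ; rewrite -E; case: (row i N != 0) => //.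
  by rewrite add0n ltnn.
have rN : realizes N (face chi J) by [].
by split; [apply: realizes_ranklike rN | exists N].
Qed.

(** A tame [chi] is covered once it is met, and then so is everything below it. For wild [chi] the
    two cases of [wild_prec] apply. *)
Lemma prec_gen_covers z chi psi : lim_meets z chi -> prec_gen K psi chi -> lim_covers z psi.
Proof.
move=> mt [ipsi ichi le [P [rP rP' [B BP lt]]]].
have [N rN] := meets_realizes mt; have rc := realizes_ranklike rN.
have [N' /realizes_ranklike rp] := (image_realizes psi).1 ipsi.
have [t|w] := boolP (tame chi).
  move=> M rM; apply: (covers_below _ (tame_covers t mt) rM le); by exists N.
have [B0 sB dB] := rho_block rc rP BP; have [_ sB' _] := rho_block rp rP' BP.
case: (wild_prec rc rp w le B0 sB dB sB' lt) => [[big p2] M [M0 ME]|[J [fJ t le']] M rM].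
  have [Z [Z0 ZE] LZ] := mt; apply: lim_orbm_trans LZ _; apply: lim_rank2 => //; by rewrite ?ZE ?ME.
have [rf ex] := face_ranklike (meets_realizes mt) fJ.
apply: (covers_below ex _ rM le'); apply: tame_covers => //.
exact: meets_face mt erefl rf.
Qed.

Lemma prec_image psi chi : prec K psi chi -> image_pi K psi /\ image_pi K chi.
Proof. by elim=> [x y [] //|x y w _ [? _] _ [_ ?]]. Qed.

Lemma covers_meets z psi : image_pi K psi -> lim_covers z psi -> lim_meets z psi.
Proof. by move=> /image_realizes[M rM] cov; exists M => //; apply: cov. Qed.

Lemma prec_covers z chi psi : lim_meets z chi -> prec K psi chi -> lim_covers z psi.
Proof.
move=> mt h; elim: h mt => [x y g mt|x y w xy IH1 yw IH2 mt]; first exact: prec_gen_covers g.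
by apply/IH1/covers_meets; [case: (prec_image yw) | apply: IH2].
Qed.

Lemma meets_block z chi psi : image_pi K psi -> lim_meets z chi -> block_degeneration psi chi -> lim_meets z psi.
Proof.
move=> ipsi mt [le [P rP PE]].
have [N rN] := (image_realizes psi).1 ipsi; have rp := realizes_ranklike rN.
have [N' rN'] := meets_realizes mt; have rc := realizes_ranklike rN'.
have [t|w] := boolP (tame chi).
  by exists N => //; apply: (covers_below _ (tame_covers t mt) rN le); exists N'.
have [|->//|[i [c2 c3 p2 pE]]] := wild_block rc rp w le.
  move=> i; have /and3P[/and3P[/eqP cP _ _] _ _] := rP.
  have : i \in cover P by rewrite cP.
  case/bigcupP => B BP iB; have [_ sB dB] := rho_block rc rP BP.
  by exists B; split=> //; apply: PE.
have [Z [Z0 ZE] LZ] := mt; rewrite -ZE in c2 c3 pE.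
have [M [LM M0 ME]] := lim_block charK Z0 rp c2 c3 p2 pE.
by exists M; [split | apply: lim_orbm_trans LZ LM].
Qed.

Lemma preceq_meets z chi psi : preceq K psi chi -> lim_meets z chi -> lim_meets z psi.
Proof.
elim=> [x y [ix iy h] mt|//|x y w _ IH1 _ IH2 mt]; last by apply/IH1/IH2.
have [N rN] := meets_realizes mt; have ry := realizes_ranklike rN.
have [N' /realizes_ranklike rx] := (image_realizes x).1 ix.
case: h => [[r [J [_ E]]]|h|h].
- apply: (meets_face (J := J) mt) => //; apply/ffunP => I.
  by apply/eqP; rewrite -(eqn_add2r (y J)) E faceE.
- exact: meets_block h.
- by apply: covers_meets => //; apply: prec_covers h.
Qed.

Lemma reach1_preceq psi chi : image_pi K psi -> image_pi K chi -> reach1 psi chi -> preceq K psi chi.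
Proof.
move=> ip ic [->|h]; first exact: rt_refl.
by apply: rt_step; split=> //; constructor 2.
Qed.

Lemma face_preceq chi J : image_pi K chi -> flat chi J ->
  image_pi K (face chi J) /\ preceq K (face chi J) chi.
Proof.
move=> ic fJ; have ex := (image_realizes chi).1 ic.
have [_ ex'] := face_ranklike ex fJ; have ip := (image_realizes _).2 ex'.
have [N /realizes_ranklike rc] := ex.
split=> //; apply: rt_step; split=> //; constructor 1; exists (chi J), J.
by split; [apply: flat_face | move=> I; rewrite faceE].
Qed.

Lemma reach_preceq psi chi : image_pi K psi -> image_pi K chi -> setfun_le psi chi ->
  reach psi chi -> preceq K psi chi.
Proof.
move=> ip ic le [->|h|[J fJ r]|[J fJ [J' fJ' r]]]; first exact: rt_refl.
- by apply: rt_step; split=> //; constructor 3; apply: t_step; split.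
- have [i1 p1] := face_preceq ic fJ.
  by apply: rt_trans p1; apply: reach1_preceq.
- have [i1 p1] := face_preceq ic fJ; have [i2 p2] := face_preceq i1 fJ'.
  by apply: rt_trans (rt_trans _ _ _ _ _ p2 p1); apply: reach1_preceq.
Qed.

End Degenerations.

From mathcomp Require Import classical_sets.

(** * Zariski closures of orbits and strata *)

Section Closure.
Variable K : fieldType.
Hypothesis charK : [pchar K] =i pred0.
Implicit Types (M N z : 'M[K]_(5, 4)) (x y : config K) (A : set (config K)).

Definition reprs (A : set (config K)) : 'M[K]_(5, 4) -> Prop := fun N => exists2 y, A y & repr_by N y.

Lemma lim_closure (A : set (config K)) M x : repr_by M x -> lim (reprs A) M -> zariski_closure A x.
Proof.
move=> hM lM Z [[E hE ->] AZ] p Ep M' hM'.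
apply: (@lim_evalm _ charK (reprs A)) => [N [y Ay hN]|].
  by have := AZ y Ay; apply.
(* Vanishing is required at every representative of [x]; they differ by row scalings, which preserve
   [reprs A]. *)
have [s s0 ->] := repr_scale hM hM'.
rewrite -[_ *m M]mulmx1; apply: lim_act lM => N [y Ay hN]; exists y => // i.
rewrite hN mulmx1 row_mul row_diag_mx -scalemxAl -rowE line_scale //.
Qed.

Lemma closure_mhom (A : set (config K)) M x d f : repr_by M x -> zariski_closure A x ->
  mhom d f -> (forall N y, A y -> repr_by N y -> f N = 0) -> f M = 0.
Proof.
move=> hM cx [p dp fE] h.
suff vp : vanishes_at p x by rewrite fE; apply: vp.
have : [set x | forall q, [set p]%classic q -> vanishes_at q x]%classic x.
  apply: cx; split; last by move=> y Ay q -> N hN; rewrite -[LHS]fE; apply: h hN.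
  by exists [set p]%classic => // q ->; exists d.
exact.
Qed.

(** Otherwise a minor of size larger than [phi I] would vanish on [A] but not at [x]. *)
Lemma closure_rank A (phi : setfun 'I_5) x : (forall y, A y -> setfun_le (span_dim y) phi) ->
  zariski_closure A x -> setfun_le (span_dim x) phi.
Proof.
move=> le cx I; have [M hM] := repr_exists x; rewrite (span_dim_mrk hM).
have [f [Y [fI]]] := rank_minor M I; rewrite leqNgt; apply: contraNN => lt; apply/eqP.
apply: (closure_mhom hM cx (mhom_det f Y)) => N y Ay hN; apply/eqP/negPn/negP => /(minor_rank fI) h.
by have := leq_ltn_trans (le y Ay I) lt; rewrite (span_dim_mrk hN) ltnNge h.
Qed.

Lemma closure_quad z x0 e a b c d : repr_by z x0 -> U24 (mrk z) e a b c d ->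
  exists2 la : K, la != 0 & forall M x Y, repr_by M x -> zariski_closure (GL_orbit x0) x ->
    @quadf K e Y a b c d la M = 0.
Proof.
move=> hz /bra_ratio[la la0 E]; exists la => // M x Y hM cx.
have [deg mq] := quadf_mhom Y a b c d la.
apply: (closure_mhom hM cx mq) => N y oy hN; apply: (quadf_orbit E).
by apply/(repr_orbit hz hN).
Qed.

(** If one product of brackets is nonzero at [M], the minor keeps its full rank there and a suitable
    [Y] makes the brackets of bases nonzero. The equation with [la != 0] then forces the other
    product to be nonzero. *)
Lemma closure_Ncond z M x0 x : repr_by z x0 -> repr_by M x -> zariski_closure (GL_orbit x0) x ->
  setfun_le (mrk M) (mrk z) -> Ncond (mrk z) (mrk M).
Proof.
move=> hz hM cx le e a b c d u; have [la la0 E] := closure_quad hz u.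
have frame p q : {subset [:: p; q] <= [:: a; b; c; d]} -> bas (mrk M) e p q ->
    exists Y, forall p' q', {subset [:: p'; q'] <= [:: a; b; c; d]} -> bas (mrk M) e p' q' ->
      @bra K e Y p' q' M != 0.
  move=> pq /eqP bpq; have rk : \rank (sp M (eset e [:: a; b; c; d])) = (isSome e).+2.
    rewrite -mrkE; apply/eqP; rewrite eqn_leq; apply/andP; split.
      by have /andP[/eqP E4 _] := u; apply: leq_trans (le _) _; rewrite E4.
    rewrite -[X in (X <= _)%N]bpq; apply: mrk_mono; exact: sub_eset.
  have [B [Y [BY MB]]] := rank_frame rk; exists Y => p' q' s'.
  by apply: bra_neq0 BY MB _; apply: sub_eset.
have [ab4 cd4 ac4 bd4] : [/\ {subset [:: a; b] <= [:: a; b; c; d]}, {subset [:: c; d] <= [:: a; b; c; d]},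
    {subset [:: a; c] <= [:: a; b; c; d]} & {subset [:: b; d] <= [:: a; b; c; d]}].
  by split=> i; rewrite !inE => /orP[]->; rewrite ?orbT.
apply/idP/idP => /andP[b1 b2].
  have [Y nz] := frame _ _ ab4 b1; have := E M x Y hM cx => /eqP; rewrite subr_eq0 => /eqP E'.
  have : @bra K e Y a b M * bra Y c d M != 0 by rewrite mulf_neq0 ?nz.
  by rewrite E' mulf_eq0 negb_or mulf_eq0 negb_or => /and3P[_ /bra_bas -> /bra_bas ->].
have [Y nz] := frame _ _ ac4 b1; have := E M x Y hM cx => /eqP; rewrite subr_eq0 => /eqP E'.
have : la * (@bra K e Y a c M * bra Y b d M) != 0 by rewrite !mulf_neq0 ?nz.
by rewrite -E' mulf_eq0 negb_or => /andP[/bra_bas -> /bra_bas ->].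
Qed.

(** Otherwise both configurations supplied by [quadf_moves] would satisfy the equation with the same
    [la]. *)
Lemma quad_not_covered z x0 x e a b c d : repr_by z x0 -> U24 (mrk z) e a b c d ->
  U24 (span_dim x) e a b c d -> freeto (span_dim x) d c ->
  ~ (fiber (span_dim x) `<=` zariski_closure (GL_orbit x0))%classic.
Proof.
move=> hz u; have [M hM] := repr_exists x; rewrite (span_dim_mrk hM) => u' fr sub.
have [la la0 E] := closure_quad hz u.
have [M' [ME nE]] := quadf_moves charK u' fr.
have [x' hM'] := config_exists (mrk_nz ME (repr_neq0 hM)).
apply: (nE la la0) => Y; first by apply: (E M x Y hM); apply: sub; apply: (span_dim_mrk hM).
by apply: (E M' x' Y hM'); apply: sub; rewrite /fiber /= (span_dim_mrk hM').
Qed.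

Lemma fiber_reprs (phi : setfun 'I_5) M : realizes M phi -> reprs (fiber phi) M.
Proof.
case=> M0 ME; have [x hx] := config_exists M0; exists x => //.
by rewrite /fiber /= (span_dim_mrk hx).
Qed.

Lemma orbit_reprs z x0 M : repr_by z x0 -> orbm z M -> reprs (GL_orbit x0) M.
Proof.
move=> hz o; have M0 : forall i, row i M != 0 := mrk_nz (orbm_mrk o) (repr_neq0 hz).
by have [y hy] := config_exists M0; exists y => //; apply/(repr_orbit hz hy).
Qed.

Lemma lim_orbit_closure z x0 M x : repr_by z x0 -> repr_by M x -> lim (orbm z) M ->
  zariski_closure (GL_orbit x0) x.
Proof.
move=> hz hM L; apply: (lim_closure hM).
by apply: lim_sub L => N; apply: orbit_reprs.
Qed.

Lemma tame_orbit x y : tame (span_dim x) -> span_dim y = span_dim x -> GL_orbit x y.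
Proof.
have [M hM] := repr_exists x; have [N hN] := repr_exists y.
rewrite (span_dim_mrk hM) (span_dim_mrk hN) => t E.
by apply/(repr_orbit hM hN)/tame_orbm.
Qed.

Lemma orbit_span_dim x y : GL_orbit x y -> span_dim y = span_dim x.
Proof.
have [M hM] := repr_exists x; have [N hN] := repr_exists y.
by move/(repr_orbit hM hN)/orbm_mrk; rewrite (span_dim_mrk hM) (span_dim_mrk hN).
Qed.

End Closure.

(** * Assembly of the equational and the degeneration arguments *)

Local Open Scope classical_set_scope.
Local Open Scope ring_scope.

Theorem theorem1p5 (K : closedFieldType) (charK0 : [pchar K] =i pred0)
    (phi : setfun 'I_5) (phi_im : image_pi K phi)
    (orb : set (config K)) (orb_orbit : is_GL_orbit orb) (orb_sub : orb `<=` fiber phi) :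
  (orb = fiber phi ->
     let below := [set psi | image_pi K psi /\ setfun_le psi phi] in
     zariski_closure orb = \bigcup_(psi in below) fiber psi
     /\ trivIset below (fun psi => fiber psi : set (config K)))
  /\
  (orb `<` fiber phi ->
     forall psi : setfun 'I_5, image_pi K psi ->
       ((fiber psi `&` zariski_closure orb !=set0) <-> preceq K psi phi)
       /\
       (fiber psi `<=` zariski_closure orb <->
          (preceq K psi phi /\ is_GL_orbit (fiber psi : set (config K)))
          \/ prec K psi phi)).
Proof.
have [x0 orbE] := orb_orbit; have [z hz] := repr_exists x0.
have x0orb : orb x0 by rewrite orbE; apply/(repr_orbit hz hz)/orbm_refl.
have zphi : mrk z = phi by rewrite -(span_dim_mrk hz); apply: orb_sub.
have z0 := repr_neq0 hz; have rz : realizes z phi by [].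
have rphi := realizes_ranklike rz.
have clos_le x : zariski_closure orb x -> setfun_le (span_dim x) phi.
  by apply: closure_rank => y /orb_sub <-.
split=> [orb_fib below|[_ orb_ne] psi psi_im].
  split.
    apply/seteqP; split=> x.
      by move=> /clos_le le; exists (span_dim x) => //; split=> //; exists x.
    move=> [psi [_ le] xE]; have [M hM] := repr_exists x.
    apply: (@lim_closure _ charK0 orb _ _ hM).
    apply: (@lim_sub _ (fun P => mrk P = phi)) => [N NE|].
      rewrite orb_fib; apply: fiber_reprs; exact: ranklike_realizes NE.
    apply: (lim_below (repr_neq0 hM) _ z0 zphi) => I.
    by rewrite -(span_dim_mrk hM) xE; apply: le.
  by move=> psi psi' _ _ [x [<- <-]].
(* A tame stratum is a single orbit, which contradicts the strict inclusion. *)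
have wild_phi : ~~ tame phi.
  apply/negP => t; apply: orb_ne => y yE; rewrite orbE; apply: tame_orbit.
    by rewrite (span_dim_mrk hz) zphi.
  by rewrite yE (span_dim_mrk hz) zphi.
have mphi : lim_meets z phi by exists z => //; apply/lim_in/orbm_refl.
have clos x : zariski_closure orb x -> setfun_le (span_dim x) phi /\ Ncond phi (span_dim x).
  move=> cx; have le := clos_le x cx; split=> //; have [M hM] := repr_exists x.
  rewrite -zphi (span_dim_mrk hM) in le *.
  by apply: (closure_Ncond hz hM) => //; rewrite -orbE.
have rpsi : ranklike psi.
  by have [N] := (image_realizes K psi).1 psi_im; apply: realizes_ranklike.
have meetsE : fiber psi `&` zariski_closure orb !=set0 -> preceq K psi phi.
  move=> [x [xE /clos[]]]; rewrite xE => le N.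
  by apply: reach_preceq => //; apply: reach_below.
split; first split=> // /(preceq_meets charK0) /(_ mphi)[M [M0 ME] LM].
  have [x hx] := config_exists M0; exists x; split; first by rewrite /fiber /= (span_dim_mrk hx).
  by rewrite orbE; apply: (lim_orbit_closure charK0 hz hx LM).
split=> [sub|[[pq [w wE]]|pr] y yE]; last 2 first.
- have [M [M0 ME] LM] := preceq_meets charK0 pq mphi.
  have [x hx] := config_exists M0; have [N hN] := repr_exists y.
  (* The stratum of [psi] is one orbit, so the limit point [x] can be carried to any other point [y]
     of it. *)
  have xw : GL_orbit w x by rewrite -wE /fiber /= (span_dim_mrk hx).
  have yw : GL_orbit w y by rewrite -wE.
  have [W hW] := repr_exists w.
  rewrite orbE; apply: (lim_orbit_closure charK0 hz hN); apply: lim_orbm LM _.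
  by apply: orbm_trans (orbm_sym ((repr_orbit hW hx).1 xw)) ((repr_orbit hW hN).1 yw).
- have [N hN] := repr_exists y; rewrite orbE; apply: (lim_orbit_closure charK0 hz hN).
  apply: (prec_covers charK0 mphi pr); split; first exact: repr_neq0 hN.
  by rewrite -(span_dim_mrk hN).
have [x _ xE] := psi_im.
have cx : zariski_closure orb x by apply: sub.
have [le N] := clos x cx; rewrite xE in le N.
have pq : preceq K psi phi by apply: meetsE; exists x.
(* A tame [psi] gives the single-orbit alternative. For wild [psi] the only alternative to [prec] is
   a varying cross-ratio, which the inclusion excludes. *)
have [t|w] := boolP (tame psi).
  left; split=> //; exists x; apply/seteqP; split=> y; first by move=> yE; apply: tame_orbit; rewrite ?xE.
  by move=> /orbit_span_dim; rewrite xE.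
right; have [|[e [a [b [c [d [u u' fr]]]]]]] := wild_below rphi rpsi wild_phi w le N.
  by move=> sh; apply: t_step; split.
rewrite -zphi in u; rewrite -xE in u' fr.
by case: (quad_not_covered charK0 hz u u' fr); rewrite xE -orbE.
Qed.
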